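(* There exists an increasing sequence of compact sets $\Lambda_n\subset\Lambda$ such that $\Lambda=\overline{\bigcup_n\Lambda_n}$ and: (i) the connected components of $\bigcup_n\Lambda_n$ are integral curves of the vector field (line field) $E^u$; (ii) a point belongs to $\bigcup_n\Lambda_n$ if and only if it admits a (local) unstable manifold; its (maximal) unstable manifold is then the connected component of $\bigcup_n\Lambda_n$ containing the point; (iii) for every ergodic $F$-invariant probability $\mu$, $\mu\left(\bigcup_n\Lambda_n\right)$ equals $0$ or $1$.
   Context: Setting. $f$ is a map of $[-1,1]$ with a discontinuity at $0$, given by two branches, each an increasing $\mathcal C^{1+}$-diffeomorphism ($C^1$ with locally Hölder derivative): from $[-1,0[$ onto $[v_l,1[$ and from $]0,1]$ onto $]-1,v_r]$, where $-1<v_l<0<v_r<1$. One has $f'\ge\sqrt2$, and $f'(x)$ is of the form $1/|x|^{1-\rho}$ for $x$ close to $0$, with $\rho\in(0,1)$, so $f'(x)\to+\infty$ as $x\to0^\pm$. At $0$, $f$ is bi-valued: $f(0^-)=1$, $f(0^+)=-1$. The map $g$ is $\mathcal C^{1+}$ from $([-1,0)\cup(0,1])\times[-1,1]$ to $[-1,1]$ and extends to $\{0\}\times[-1,1]$ as a bi-valued map with $g(0^-,y)=y_+>0$ and $g(0^+,y)=y_-<0$ for every $y$, where $y_\pm\in]-1,1[$; moreover $|\partial g/\partial y|\le \frac12$ and $|\partial g/\partial x|\le M$ for some $M>0$. Put $F(x,y)=(f(x),g(x,y))$ on $[-1,1]^2$. $F$ maps $[-1,1]^2$ strictly into itself, maps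 the left part ($x<0$) and the right part ($x>0$) onto two disjoint ''triangles'', and is one-to-one except on the critical line $\{0\}\times[-1,1]$, whose two images are the points $(1,y_+)$ and $(-1,y_-)$. Standing assumption: $0$ is neither periodic nor pre-periodic for $f$. The attractor is $\Lambda=\bigcap_{n\ge0}F^n([-1,1]^2)$. $\mathcal O_F^+$ is the union of the forward $F$-orbits of $(1,y_+)$ and $(-1,y_-)$. For $z\in\Lambda\setminus\mathcal O_F^+$ the preimages $F^{-n}(z)$, $n\ge 1$, are well defined and do not lie on the critical line. Invariance of a probability $\mu$ is the usual one, with $F$ given one of its two values on the critical line. Unstable direction: at each $z\in\Lambda\setminus\mathcal O_F^+$, $E^u(z)\subset\mathbb R^2$ is the line of the unique $DF$-invariant line field on $\Lambda\setminus\mathcal O_F^+$ whose vectors are contracted exponentially under backward iteration of $DF$. Unstable manifolds: let $\pi_1(x,y)=x$ and fix $\alpha>0$ with $\alpha M<\frac12$. A point $z=(x,y)\in\Lambda\setminus\mathcal O_F^+$ admits a local unstable manifold if for some $\eta>0$ there is a curve $W\ni z$, contained in $\Lambda\setminus\mathcal O_F^+$, which is the graph of a $\frac1\alpha$-Lipschitz function over $]x-\eta/2,x+\eta/2[$, is tangent to $E^u$ at each of its points, and satisfies $0\notin\pi_1(F^{-n}(W))$ for every $n\ge1$. A $u$-curve is an integral curve of $E^u$, i.e. a curve contained in $\Lambda\setminus\mathcal O_F^+$ whose tangent line at each of its points $z$ is $E^u(z)$; the maximal unstable manifold of $z$ is the largest (for inclusion) $u$-curve containing $z$. *)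

(* Defs.v *)
From HB Require Import structures.
From mathcomp Require Import all_boot all_order all_algebra.
From mathcomp Require Import all_classical all_reals all_analysis.
Import Order.TTheory GRing.Theory Num.Theory.
Import numFieldNormedType.Exports.

Set Implicit Arguments.
Unset Strict Implicit.
Unset Printing Implicit Defensive.

Local Open Scope classical_set_scope.
Local Open Scope ring_scope.

Section Calculus.
Context {R : realType}.

(* Derivative relative to [D]: one-sided at an endpoint of [D] lying in [D]. *)
Definition has_deriv_within (D : set R) (h : R -> R) (x l : R) : Prop :=
  (h u - h x) / (u - x) @[u --> within D x^'] --> l.

Definition locally_holder {V : normedModType R} (D : set V) (h : V -> R) : Prop :=
  forall x, D x -> exists r C theta : R, [/\ 0 < r, 0 < theta <= 1 &
    forall u v, D u -> D v -> ball x r u -> ball x r v ->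
      `|h u - h v| <= C * `|u - v| `^ theta].

(* Local Hölder continuity of [dh] makes [h] of class C^1, and positivity of
   [dh] makes the inverse of [h] of the same class. *)
Definition increasing_diffeo (D D' : set R) (h dh : R -> R) : Prop :=
  [/\ h @` D = D',
      {in D &, {homo h : x y / x < y}},
      (forall x, D x -> has_deriv_within D h x (dh x)),
      (forall x, D x -> 0 < dh x) &
      locally_holder D dh].

End Calculus.

(* [df], [dgx] and [dgy] are determined by [f] and [g] on the domains below;
   all the functions are irrelevant elsewhere, in particular on [x = 0]. *)
Record lorenz_data (R : realType) := LorenzData {
  vl : R; vr : R;
  yp : R; ym : R;
  f : R -> R; df : R -> R;
  g : R * R -> R; dgx : R * R -> R; dgy : R * R -> R;
  M : R }.

Section Lorenz.
Context {R : realType} (L : lorenz_data R).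

Local Notation plane := (R * R)%type.

Definition Ileft : set R := `[-1, 0[.
Definition Iright : set R := `]0, 1].
Definition Iy : set R := `[-1, 1].
Definition square : set plane := Iy `*` Iy.

(* The bi-valued maps: the values at a point form a set. *)
Definition fval (x : R) : set R :=
  if x == 0 then [set 1; -1] else [set f L x].

Definition F (z : plane) : plane := (f L z.1, g L z).

Definition Fval (z : plane) : set plane :=
  if z.1 == 0 then [set (1, yp L); (-1, ym L)] else [set F z].

Definition Fimg (A : set plane) : set plane := \bigcup_(z in A) Fval z.

Record lorenz_map : Prop := {
  vl_bounds : -1 < vl L < 0;
  vr_bounds : 0 < vr L < 1;
  f_left : increasing_diffeo Ileft `[vl L, 1[ (f L) (df L);
  f_right : increasing_diffeo Iright `]-1, vr L] (f L) (df L);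
  df_ge : forall x, (Ileft `|` Iright) x -> Num.sqrt 2 <= df L x;
  df_near0 : exists2 rho : R, 0 < rho < 1 &
    \forall x \near 0^', df L x = 1 / `|x| `^ (1 - rho);
  yp_bounds : 0 < yp L < 1;
  ym_bounds : -1 < ym L < 0;
  g_square : forall z, ((Ileft `|` Iright) `*` Iy) z -> Iy (g L z);
  g_dx : forall x y, (Ileft `|` Iright) x -> Iy y ->
    has_deriv_within (Ileft `|` Iright) (fun u => g L (u, y)) x (dgx L (x, y));
  g_dy : forall x y, (Ileft `|` Iright) x -> Iy y ->
    has_deriv_within Iy (fun u => g L (x, u)) y (dgy L (x, y));
  dgx_holder : locally_holder ((Ileft `|` Iright) `*` Iy) (dgx L);
  dgy_holder : locally_holder ((Ileft `|` Iright) `*` Iy) (dgy L);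
  g_0left : forall y, Iy y ->
    g L z @[z --> within (Ileft `*` Iy) (nbhs (0 : R, y))] --> yp L;
  g_0right : forall y, Iy y ->
    g L z @[z --> within (Iright `*` Iy) (nbhs (0 : R, y))] --> ym L;
  M_gt0 : 0 < M L;
  dgx_le : forall z, ((Ileft `|` Iright) `*` Iy) z -> `|dgx L z| <= M L;
  dgy_le : forall z, ((Ileft `|` Iright) `*` Iy) z -> `|dgy L z| <= 1 / 2;
  F_strict : Fimg square `<` square;
  F_inj : {in (Ileft `|` Iright) `*` Iy &, injective F};
  (* No orbit of 0 takes the same value twice, whichever value of [f] is
     followed at 0. *)
  zero_not_preperiodic : forall x : nat -> R, x 0%N = 0 ->
    (forall n, fval (x n) (x n.+1)) -> injective x }.

Definition attractor : set plane := \bigcap_n iter n Fimg square.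

Definition critical_orbit : set plane :=
  \bigcup_n iter n Fimg [set (1, yp L); (-1, ym L)].

Definition Lambda_reg : set plane := attractor `\` critical_orbit.

Definition DF (z v : plane) : plane :=
  (df L z.1 * v.1, dgx L z * v.1 + dgy L z * v.2).

Definition is_line (l : set plane) : Prop :=
  exists2 v : plane, v != 0 & l = [set (t * v.1, t * v.2) | t in setT].

(* Backward iteration is written along backward orbits [z] and their lifts [v],
   as [DF] need not be invertible. *)
Definition is_unstable_field (E : plane -> set plane) : Prop :=
  [/\ (forall z, Lambda_reg z -> is_line (E z)),
      (forall z, Lambda_reg z -> z.1 != 0 -> DF z @` E z = E (F z)) &
      exists C lambda : R, 0 < lambda < 1 /\
        forall z v : nat -> plane,
          (forall n, Lambda_reg (z n) /\ E (z n) (v n)) ->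
          (forall n, [/\ (z n.+1).1 != 0, F (z n.+1) = z n &
                         DF (z n.+1) (v n.+1) = v n]) ->
          forall n, `|v n| <= C * lambda ^+ n * `|v 0%N| ].

(* The field is unique on [Lambda_reg] only; its values elsewhere are never
   used. *)
Definition Eu : plane -> set plane := get is_unstable_field.

(* Curves have no endpoints: they are images of regular C^1 paths defined on an
   open interval. *)
Definition u_curve (W : set plane) : Prop :=
  W `<=` Lambda_reg /\
  exists a b : R, a < b /\ exists c1 c2 dc1 dc2 : R -> R,
    [/\ W = [set (c1 t, c2 t) | t in `]a, b[%classic],
        {in `]a, b[, forall t,
          is_derive t (1 : R) c1 (dc1 t) /\ is_derive t (1 : R) c2 (dc2 t)},
        {in `]a, b[, forall t,
          {for t, continuous dc1} /\ {for t, continuous dc2}} &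
        {in `]a, b[, forall t, (dc1 t, dc2 t) != 0 /\
          Eu (c1 t, c2 t) = [set (s * dc1 t, s * dc2 t) | s in setT]}].

Definition is_maximal_unstable_manifold (z : plane) (W : set plane) : Prop :=
  [/\ u_curve W, W z &
      forall W', u_curve W' -> W' z -> W' `<=` W].

Definition Fpreimg (n : nat) (W : set plane) : set plane :=
  [set w | square w /\ iter n Fimg [set w] `&` W !=set0].

Definition admits_unstable_manifold (alpha : R) (z : plane) : Prop :=
  Lambda_reg z /\
  exists eta : R, 0 < eta /\ exists phi : R -> R,
    let I : set R := `]z.1 - eta / 2, z.1 + eta / 2[%classic in
    let W : set plane := [set (t, phi t) | t in I] in
    [/\ W z,
        W `<=` Lambda_reg,
        alpha^-1.-lipschitz_I phi,
        (forall t, I t -> derivable phi t 1 /\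
           Eu (t, phi t) = [set (s, s * derive1 phi t) | s in setT]) &
        forall n w, (0 < n)%N -> Fpreimg n W w -> w.1 != 0].

(* [F] with one of its two values chosen on the critical line. *)
Definition Fsel (left : bool) (z : plane) : plane :=
  if z.1 == 0 then (if left then (1, yp L) else (-1, ym L)) else F z.

Local Notation mplane := (measurableTypeR R * measurableTypeR R)%type.

(* [Fsel] only matters on [square], which carries the measure. *)
Definition is_invariant (left : bool) (mu : probability mplane R) : Prop :=
  mu square = 1%E /\
  forall A : set mplane, measurable A ->
    mu (square `&` Fsel left @^-1` A) = mu A.

Definition is_ergodic (left : bool) (mu : probability mplane R) : Prop :=
  is_invariant left mu /\
  forall A : set mplane, measurable A ->
    square `&` Fsel left @^-1` A = square `&` A -> mu A = 0%E \/ mu A = 1%E.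

End Lorenz.

(* Main.v *)
Require Import Defs.
From mathcomp Require Import all_boot all_order all_algebra.
From mathcomp Require Import all_classical all_reals all_analysis.
From mathcomp Require Import ring lra.
Import Order.TTheory GRing.Theory Num.Theory.
Import numFieldNormedType.Exports.
Local Open Scope classical_set_scope.
Local Open Scope ring_scope.

(* A point of Lambda off the critical orbit has a unique backward orbit; its
   itinerary records on which side of 0 each preimage lies.  As fibres are
   contracted, the points sharing an itinerary form a 2M-Lipschitz graph (a
   leaf) over the set of abscissas on which all the inverse branches of f
   prescribed by the itinerary are defined, and this set is an interval.
   Itineraries are locally constant, hence constant on connected sets, so that
   a point admits an unstable manifold iff its abscissa is interior to the
   domain of its leaf, and the unstable manifold is the leaf over the interior
   of this domain.  Lambda_n consists of the points whose leaf is defined at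
   distance less than 1/(n+1) of their abscissa; it is closed because an
   ultrafilter of such points has a limit itinerary.

   For the density, expansion by at least sqrt 2 makes some image of ]0, v_r[
   cover ]0, v_r[ through a single branch of an iterate of f, whence a leaf with
   periodic itinerary over ]0, v_r[, and two images of this leaf project onto
   ]-1, 1[; contraction of the fibres then spreads these leaves densely over
   Lambda.

   The union U of the Lambda_n satisfies F^-1(U) = U minus the critical line;
   removing the preimages of the critical line gives an invariant set of the
   same measure as U. *)

Set Implicit Arguments.
Unset Strict Implicit.

(** * Real functions and contracting sequences *)

Section RealLemmas.
Context {R : realType}.
Implicit Types (D : set R) (h dh : R -> R).

(** Clearing the denominator also covers [u = x], which the punctured limit leaves out; the
    derivative estimates below use this form. *)
Lemma deriv_within_eps D h x l : has_deriv_within D h x l ->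
  forall e, 0 < e -> exists2 d, 0 < d & forall u, D u -> `|u - x| < d ->
    `|h u - h x - l * (u - x)| <= e * `|u - x|.
Proof.
move=> /cvgrPdist_le H e e0; have := H e e0.
rewrite near_withinE near_withinE => /nbhs_ballP[d /= d0 Hd].
exists d => // u Du ux.
have [->|neq] := eqVneq u x; first by rewrite !subrr mulr0 subr0 normr0 mulr0.
have ux0 : 0 < `|u - x| by rewrite normr_gt0 subr_eq0.
have := Hd u; rewrite /ball /= distrC => /(_ ux neq Du) {}H1.
have -> : h u - h x - l * (u - x) = - ((l - (h u - h x) / (u - x)) * (u - x)).
  by rewrite mulrBl divfK ?subr_eq0// opprB.
by rewrite normrN normrM ler_pM2r.
Qed.

Lemma eps_is_derive h (x l : R) :
  (forall e, 0 < e -> exists2 d, 0 < d & forall u, `|u - x| < d ->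
    `|h u - h x - l * (u - x)| <= e * `|u - x|) -> is_derive x 1 h l.
Proof.
move=> H.
suff cv : (k^-1 *: ((h \o shift x) (k *: (1:R)) - h x) @[k --> 0^']) --> l.
  by split; [apply/cvg_ex; exists l|apply: cvg_lim].
apply/cvgrPdist_le => e e0; have [d d0 Hd] := H e e0.
rewrite near_withinE; apply/nbhs_ballP; exists d => //= k.
rewrite /ball /= sub0r normrN => kd k0.
have := Hd (k + x); rewrite addrK => /(_ kd) H1.
have k0' : 0 < `|k| by rewrite normr_gt0.
rewrite /= distrC -(ler_pM2r k0') -normrM mulrBl.
suff -> : k^-1 *: (h (k *: 1 + x) - h x) * k = h (k + x) - h x by [].
by rewrite [k *: 1]mulr1 [_ *: _]mulrC divfK.
Qed.

Lemma eps_within_continuous D h :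
  (forall x, D x -> forall e, 0 < e -> exists2 d, 0 < d &
    forall u, D u -> `|u - x| < d -> `|h u - h x| <= e) ->
  {within D, continuous h}.
Proof.
move=> H; apply/subspace_continuousP => x Dx.
apply/cvgrPdist_le => e e0; have [d d0 Hd] := H x Dx e e0.
rewrite near_withinE; apply/nbhs_ballP; exists d => //= u.
by rewrite /ball /= distrC => ud Du; rewrite distrC; apply: Hd.
Qed.

Lemma deriv_within_lip D h x l : has_deriv_within D h x l ->
  exists2 d, 0 < d & forall u, D u -> `|u - x| < d ->
    `|h u - h x| <= (`|l| + 1) * `|u - x|.
Proof.
move=> /deriv_within_eps/(_ _ ltr01)[d d0 Hd]; exists d => // u Du ud.
have := Hd u Du ud; have := ler_normD (h u - h x - l * (u - x)) (l * (u - x)).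
rewrite subrK normrM; set A := `| _ - _ - _ |; lra.
Qed.

Lemma deriv_within_cont D h x l : has_deriv_within D h x l ->
  forall e, 0 < e -> exists2 d, 0 < d & forall u, D u -> `|u - x| < d ->
    `|h u - h x| <= e.
Proof.
move=> /deriv_within_lip[d d0 Hd] e e0.
have l0 : 0 < `|l| + 1 by rewrite ltr_wpDl.
exists (Num.min d (e / (`|l| + 1))); first by rewrite lt_min d0 divr_gt0.
move=> u Du; rewrite lt_min => /andP[ud ue].
apply: le_trans (Hd u Du ud) _.
by rewrite -ler_pdivlMl// mulrC ltW.
Qed.

(** A point of []a, b[] has a neighbourhood inside [D], so the relative derivative there is a
    genuine one; at [a] and [b] only continuity is needed. *)
Lemma mvt_within D h dh a b : a < b -> (forall x, a <= x <= b -> D x) ->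
  (forall x, a <= x <= b -> has_deriv_within D h x (dh x)) ->
  exists2 c, a < c < b & h b - h a = dh c * (b - a).
Proof.
move=> ab sub Hd.
have [||c] := @MVT R h dh a b ab; last by rewrite in_itv /=; exists c.
- move=> x; rewrite in_itv /= => /andP[ax xb].
  apply: eps_is_derive => e e0.
  have xab : a <= x <= b by rewrite !ltW.
  have [d d0 H] := deriv_within_eps (Hd x xab) e0.
  exists (Num.min d (Num.min (x - a) (b - x))).
    by rewrite !lt_min d0 !subr_gt0 ax xb.
  move=> u; rewrite !lt_min => /and3P[ud ua ub]; apply: H => //.
  by apply: sub; move: ua ub; rewrite !ltr_norml; lra.
- apply: eps_within_continuous => x; rewrite /= in_itv /= => xab e e0.
  have [d d0 H] := deriv_within_cont (Hd x xab) e0.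
  by exists d => // u; rewrite in_itv /= => /sub/H.
Qed.

Lemma holder_eps {V : normedModType R} (D : set V) (h : V -> R) x :
  locally_holder D h -> D x -> forall e : R, 0 < e -> exists2 d, 0 < d &
    forall u, D u -> `|u - x| < d -> `|h u - h x| <= e.
Proof.
move=> H Dx e e0; have [r [C [th [r0 /andP[th0 th1] HC]]]] := H x Dx.
have C1 : 0 < `|C| + 1 by rewrite ltr_wpDl.
(* [C] may have any sign, hence the positive denominator. For [|u - x|] below [q] to the power
   [1 / th], the Hölder term is at most [(|C| + 1) * q = e]. *)
pose q := e / (`|C| + 1); have q0 : 0 < q by rewrite divr_gt0.
exists (Num.min r (q `^ th^-1)); first by rewrite lt_min r0 powR_gt0.
move=> u Du; rewrite lt_min => /andP[ur uq].
have H1 : `|h u - h x| <= C * `|u - x| `^ th.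
  apply: HC => //; last exact: ballxx.
  by rewrite -ball_normE /= distrC.
have H2 : `|u - x| `^ th <= q.
  have -> : q = (q `^ th^-1) `^ th.
    by rewrite -powRrM mulVf ?lt0r_neq0// powRr1// ltW.
  by apply: ge0_ler_powR; rewrite ?nnegrE ?powR_ge0// ?ltW.
apply: le_trans H1 _.
have H3 : (`|C| + 1) * q = e by rewrite mulrC divfK ?lt0r_neq0.
have := ler_norm C; have := powR_ge0 `|u - x| th; have := normr_ge0 C.
move: H2 H3; nra.
Qed.

Lemma half_pow_small (C e : R) : 0 < e -> exists n, C / 2 ^+ n <= e.
Proof.
move=> e0; have [C0|C0] := lerP C 0.
  by exists 0%N; rewrite expr0 divr1; apply: le_trans C0 (ltW e0).
exists (Num.truncn (C / e)).+1.
rewrite ler_pdivrMr ?exprn_gt0// mulrC -ler_pdivrMr//.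
apply: le_trans (ltW (truncnS_gt _)) _.
by rewrite -natrX ler_nat ltnW// ltn_expl.
Qed.

Lemma le_half_pow (a b C : R) :
  (forall n, a <= b + C / 2 ^+ n) -> a <= b.
Proof.
move=> H; apply/ler_addgt0Pr => e e0.
by have [n Hn] := half_pow_small C e0; apply: le_trans (H n) _; rewrite lerD2l.
Qed.

Lemma cauchy_half (u : nat -> R) (C : R) :
  (forall n, `|u n.+1 - u n| <= C / 2 ^+ n) ->
  exists l, forall n, `|l - u n| <= 2 * C / 2 ^+ n.
Proof.
move=> H.
have C0 : 0 <= C by have := H 0%N; rewrite expr0 divr1; apply: le_trans.
(* Subtracting the tail that is still to come makes the induction on [k] close by telescoping. *)
have step n k : `|u (n + k)%N - u n| <= 2 * C / 2 ^+ n - 2 * C / 2 ^+ (n + k).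
  elim: k => [|k IH]; first by rewrite addn0 !subrr normr0.
  have := H (n + k)%N; have := ler_distD (u (n + k)%N) (u (n + k).+1) (u n).
  have -> : C / 2 ^+ (n + k) = 2 * C / 2 ^+ (n + k) - 2 * C / 2 ^+ (n + k).+1.
    by rewrite exprS invfM; field; rewrite expf_neq0.
  rewrite addnS; move: IH; lra.
have step' n k : (n <= k)%N -> `|u k - u n| <= 2 * C / 2 ^+ n.
  move=> /subnKC <-; apply: le_trans (step _ _) _.
  by rewrite lerBlDr lerDl divr_ge0 ?exprn_ge0// mulr_ge0.
have cu : cvgn u.
  apply/cauchy_cvgP/cauchy_exP => e e0.
  have e20 : 0 < e / 2 by rewrite divr_gt0.
  have [n Hn] := half_pow_small (2 * C) e20.
  exists (u n); exists n => // k /= nk; rewrite -ball_normE /= distrC.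
  apply: le_lt_trans (step' _ _ nk) _; apply: le_lt_trans Hn _.
  by rewrite ltr_pdivrMr// ltr_pMr// ltr1n.
exists (limn u) => n; apply/ler_addgt0Pr => e e0.
have /cvgrPdist_le/(_ e e0)[N _ HN] := cu.
have := HN (maxn n N) (leq_maxr _ _); have := step' n _ (leq_maxl n N).
have := ler_distD (u (maxn n N)) (limn u) (u n); rewrite /=; lra.
Qed.

(** [A k n] solves the system with the value 0 imposed at index [n + k]. Each application of [G]
    halves differences, so the approximations converge geometrically, uniformly in [n]. The lemma
    yields both the ordinates of backward orbits and the unstable slopes. *)
Lemma backward_fixed_seq (B : R) (G : nat -> R -> R) : 0 <= B ->
  (forall n y, `|y| <= B -> `|G n y| <= B) ->
  (forall n y y', `|y| <= B -> `|y'| <= B ->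
     `|G n y - G n y'| <= `|y - y'| / 2) ->
  exists ys : nat -> R, forall n, `|ys n| <= B /\ ys n = G n (ys n.+1).
Proof.
move=> B0 GB GL.
pose fix A k n {struct k} := if k is k'.+1 then G n (A k' n.+1) else 0.
have AB k n : `|A k n| <= B.
  by elim: k n => [|k IH] n /=; [rewrite normr0|apply: GB].
have Ast k n : `|A k.+1 n - A k n| <= B / 2 ^+ k.
  elim: k n => [|k IH] n; first by rewrite expr0 divr1 subr0; apply: (AB 1%N).
  apply: le_trans (GL n _ _ (AB k.+1 n.+1) (AB k n.+1)) _.
  rewrite exprSr invfM mulrA ler_pM2r ?invr_gt0//; exact: IH.
have /choice[ys Hys] : forall n, exists l, forall k,
    `|l - A k n| <= 2 * B / 2 ^+ k.
  by move=> n; apply: cauchy_half.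
have ysB n : `|ys n| <= B.
  apply: (@le_half_pow _ _ (2 * B)) => k; have := Hys n k; have := AB k n.
  have := ler_normD (ys n - A k n) (A k n); rewrite subrK.
  set x := `|_ - _|; lra.
exists ys => n; split => //; apply/eqP; rewrite -subr_eq0 -normr_le0.
apply: (@le_half_pow _ _ (2 * B)) => k; rewrite add0r.
have H1 := Hys n k.+1; have := GL n _ _ (ysB n.+1) (AB k n.+1).
have H2 := Hys n.+1 k; have := ler_distD (A k.+1 n) (ys n) (G n (ys n.+1)).
rewrite exprSr invfM mulrA in H1; rewrite /= [`|A k.+1 n - _|]distrC /=.
move: H1 H2 => /=; lra.
Qed.

Lemma ultra_compact_cvg {T : Type} {X : topologicalType} (G : set_system T)
    (A : set X) (a : T -> X) : UltraFilter G -> compact A ->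
  (\forall t \near G, A (a t)) -> exists2 p, A p & a @ G --> p.
Proof.
move=> GU cA GA.
have [p [Ap cp]] := cA (a @ G) _ GA.
exists p => // V Vp; case: (in_ultra_setVsetC (a @^-1` V) GU) => // H.
have := cp (~` V) V H Vp; by case => x [].
Qed.

(** Two bounded solutions differ by at most [2 * B] at every index, and going down [k] indices
    divides this by [2 ^ k]. *)
Lemma backward_fixed_unique (B : R) (G : nat -> R -> R)
    (ys ys' : nat -> R) :
  (forall n y y', `|y| <= B -> `|y'| <= B ->
     `|G n y - G n y'| <= `|y - y'| / 2) ->
  (forall n, `|ys n| <= B /\ ys n = G n (ys n.+1)) ->
  (forall n, `|ys' n| <= B /\ ys' n = G n (ys' n.+1)) -> ys =1 ys'.
Proof.
move=> GL H H' n; apply/eqP; rewrite -subr_eq0 -normr_le0.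
apply: (@le_half_pow _ _ (2 * B)) => k; rewrite add0r.
elim: k n => [|k IH] n.
  rewrite expr0 divr1; have [+ _] := H n; have [+ _] := H' n.
  by rewrite !ler_norml; lra.
have [_ ->] := H n; have [_ ->] := H' n.
apply: le_trans (GL n _ _ (H n.+1).1 (H' n.+1).1) _.
by rewrite exprSr invfM mulrA ler_pM2r ?invr_gt0//; exact: IH.
Qed.

Lemma is_derive_eps (h : R -> R) (x l : R) : is_derive x 1 h l ->
  forall e, 0 < e -> exists2 d, 0 < d & forall u, `|u - x| < d ->
    `|h u - h x - l * (u - x)| <= e * `|u - x|.
Proof.
move=> [dh <-] e e0.
have /cvgrPdist_le/(_ e e0) : (k^-1 *: ((h \o shift x) (k *: (1:R)) - h x)
    @[k --> 0^']) --> 'D_1 h x by [].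
rewrite near_withinE => /nbhs_ballP[d /= d0 Hd].
exists d => // u ud.
have [->|neq] := eqVneq u x; first by rewrite !subrr mulr0 subr0 normr0 mulr0.
have ux0 : 0 < `|u - x| by rewrite normr_gt0 subr_eq0.
have := Hd (u - x); rewrite /ball /= sub0r normrN => /(_ ud).
rewrite subr_eq0 => /(_ neq).
set D := 'D_1 h x; rewrite /= -(ler_pM2r ux0) -normrM distrC.
apply: le_trans; rewrite le_eqVlt; apply/orP; left; apply/eqP.
rewrite -[LHS]normrN; congr `|_|.
rewrite [(u - x) *: 1]mulr1 subrK mulrBl [_ *: _]mulrC divfK ?subr_eq0//.
by rewrite opprB.
Qed.

Lemma closure_of_cvg {T : Type} {X : topologicalType} (G : set_system T)
    (A : set X) (a : T -> X) (x : X) : ProperFilter G -> a @ G --> x ->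
  (\forall t \near G, A (a t)) -> closure A x.
Proof.
move=> PG ax GA V Vx; have [t [h1 h2]] := filter_ex (filterI GA (ax V Vx)).
by exists (a t).
Qed.

End RealLemmas.

(** * The branches of the map *)

Section BranchFacts.
Context {R : realType} (L : lorenz_data R) (hL : lorenz_map L).
Local Notation plane := (R * R)%type.
Local Notation f := (Defs.f L).
Local Notation df := (Defs.df L).
Local Notation g := (Defs.g L).
Local Notation dgx := (Defs.dgx L).
Local Notation dgy := (Defs.dgy L).
Local Notation M := (Defs.M L).

(* Throughout, true stands for the left side of 0 and false for the right. *)
Definition br (s : bool) : set R := if s then Ileft else Iright.
Definition dom (s : bool) : set R :=
  if s then `[vl L, 1[%classic else `]-1, vr L]%classic.

Lemma squareP (z : plane) :
  square z <-> (-1 <= z.1 <= 1) /\ (-1 <= z.2 <= 1).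
Proof. by rewrite /square /Iy /setX /= !in_itv. Qed.

Lemma IyP (y : R) : Iy y <-> -1 <= y <= 1.
Proof. by rewrite /Iy /= in_itv. Qed.

Lemma brP s (x : R) :
  br s x <-> if s then -1 <= x < 0 else 0 < x <= 1.
Proof. by case: s; rewrite /br /Ileft /Iright /= in_itv. Qed.

Lemma domP s (x : R) :
  dom s x <-> if s then vl L <= x < 1 else -1 < x <= vr L.
Proof. by case: s; rewrite /dom /= in_itv. Qed.

Lemma br_bounds s (x : R) : br s x -> -1 <= x <= 1.
Proof. by move/brP; case: s; lra. Qed.

Lemma br_neq0 s (x : R) : br s x -> x != 0.
Proof. by move/brP; case: s => h; apply/eqP; lra. Qed.

Lemma brU s (x : R) : br s x -> (Ileft `|` Iright) x.
Proof. by case: s; [left|right]. Qed.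

Lemma br_sign s (x : R) : br s x -> (x < 0) = s.
Proof. by move/brP; case: s; lra. Qed.

Lemma br_of (x : R) : -1 <= x <= 1 -> x != 0 -> br (x < 0) x.
Proof.
move=> xI /eqP x0; apply/brP.
have [xn|xp] := ltP x 0; first lra.
have : x <> 0 by [].
rewrite le_eqVlt eq_sym in xp; case/orP: xp => [/eqP//|]; lra.
Qed.

Lemma br_convex s (x y u : R) : br s x -> br s y -> x <= u <= y -> br s u.
Proof. by rewrite !brP; case: s; lra. Qed.

Lemma f_diffeo s : increasing_diffeo (br s) (dom s) f df.
Proof. by case: s; [exact: f_left hL|exact: f_right hL]. Qed.

Lemma f_dom s x : br s x -> dom s (f x).
Proof. by move=> xs; case: (f_diffeo s) => <- _ _ _ _; exists x. Qed.

Lemma f_surj s t : dom s t -> exists2 x, br s x & f x = t.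
Proof. by case: (f_diffeo s) => <-. Qed.

Lemma f_strict s x : br s x -> -1 < f x < 1.
Proof.
move=> /f_dom/domP; have := vl_bounds hL; have := vr_bounds hL.
by case: s; lra.
Qed.

Lemma df_sqrt s x : br s x -> Num.sqrt 2 <= df x.
Proof. by move/brU; exact: df_ge hL x. Qed.

(** A rational bound suited to [lra] and [nra]; inverse branches of [f] then contract by [3 / 4]. *)
Lemma sqrt2_gt : 4 / 3 < Num.sqrt (2 : R).
Proof.
have -> : 4 / 3 = Num.sqrt ((4 / 3 : R) ^+ 2) by rewrite sqrtr_sqr ger0_norm//; lra.
by rewrite ltr_sqrt; lra.
Qed.

Lemma f_mvt s x y : br s x -> br s y -> x < y ->
  exists2 c, x < c < y & f y - f x = df c * (y - x).
Proof.
move=> xs ys xy; have [_ _ fd _ _] := f_diffeo s.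
apply: (@mvt_within _ (br s)) => // u xuy; last apply: fd;
  exact: br_convex xs ys xuy.
Qed.

Lemma f_expand s x y : br s x -> br s y -> x <= y ->
  Num.sqrt 2 * (y - x) <= f y - f x.
Proof.
move=> xs ys; rewrite le_eqVlt => /predU1P[->|xy]; first by rewrite !subrr mulr0.
have [c /andP[xc cy] ->] := f_mvt xs ys xy.
have cs : br s c by apply: br_convex xs ys _; rewrite !ltW.
by rewrite ler_pM2r ?subr_gt0//; exact: df_sqrt cs.
Qed.

Lemma f_expand1 s x y : br s x -> br s y -> x <= y -> y - x <= f y - f x.
Proof.
move=> xs ys xy; have := f_expand xs ys xy; have := sqrt2_gt.
have := subr_ge0 x y; rewrite xy; nra.
Qed.

Lemma f_lt s x y : br s x -> br s y -> (f x < f y) = (x < y).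
Proof.
move=> xs ys; have [xy|yx] := ltP x y.
  by have := f_expand1 xs ys (ltW xy); lra.
by have := f_expand1 ys xs yx; lra.
Qed.

Lemma f_le s x y : br s x -> br s y -> (f x <= f y) = (x <= y).
Proof. by move=> xs ys; rewrite !leNgt (f_lt ys xs). Qed.

Lemma f_inj s x y : br s x -> br s y -> f x = f y -> x = y.
Proof.
move=> xs ys e; apply/eqP; rewrite eq_le -(f_le xs ys) -(f_le ys xs) e.
by rewrite lexx.
Qed.

Lemma f_dist s x y : br s x -> br s y -> `|x - y| <= `|f x - f y|.
Proof.
move=> xs ys; wlog xy : x y xs ys / x <= y => [H|].
  have [/H|/ltW yx] := leP x y; first exact.
  by rewrite distrC [leRHS]distrC; apply: H.
have H := f_expand1 xs ys xy; rewrite distrC [leRHS]distrC.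
by rewrite !ger0_norm ?subr_ge0// (f_le xs ys).
Qed.

Lemma f_cont s x : br s x -> forall e : R, 0 < e -> exists2 d, 0 < d &
  forall u, br s u -> `|u - x| < d -> `|f u - f x| <= e.
Proof. by move=> xs; have [_ _ fd _ _] := f_diffeo s; exact/deriv_within_cont/fd. Qed.

Lemma df_cont s x : br s x -> forall e : R, 0 < e -> exists2 d, 0 < d &
  forall u, br s u -> `|u - x| < d -> `|df u - df x| <= e.
Proof. by move=> xs; have [_ _ _ _ fh] := f_diffeo s; exact: (holder_eps fh). Qed.

Lemma M_gt0' : 0 < M. Proof. exact: M_gt0 hL. Qed.

Lemma dgx_bound s x y : br s x -> Iy y -> `|dgx (x, y)| <= M.
Proof. by move=> xs yI; apply: (dgx_le hL); split => //; exact: brU xs. Qed.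

Lemma dgy_bound s x y : br s x -> Iy y -> `|dgy (x, y)| <= 1 / 2.
Proof. by move=> xs yI; apply: (dgy_le hL); split => //; exact: brU xs. Qed.

Lemma g_Iy s x y : br s x -> Iy y -> Iy (g (x, y)).
Proof. by move=> xs yI; apply: (g_square hL); split => //; exact: brU xs. Qed.

Lemma g_mvt_x s x x' y : br s x -> br s x' -> Iy y -> x < x' ->
  exists2 c, x < c < x' & g (x', y) - g (x, y) = dgx (c, y) * (x' - x).
Proof.
move=> xs x's yI xx'.
apply: (@mvt_within _ (Ileft `|` Iright) (fun u => g (u, y))
  (fun u => dgx (u, y))) => // u xux'.
  exact/brU/(br_convex xs x's).
by apply: (g_dx hL) => //; exact/brU/(br_convex xs x's).
Qed.

Lemma g_mvt_y s x y y' : br s x -> Iy y -> Iy y' -> y < y' ->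
  exists2 c, y < c < y' & g (x, y') - g (x, y) = dgy (x, c) * (y' - y).
Proof.
move=> xs /IyP yI /IyP y'I yy'.
apply: (@mvt_within _ Iy (fun u => g (x, u)) (fun u => dgy (x, u))) => // u yuy'.
  by apply/IyP; lra.
by apply: (g_dy hL); [exact: brU xs|apply/IyP; lra].
Qed.

Lemma g_lip_x s x x' y : br s x -> br s x' -> Iy y ->
  `|g (x, y) - g (x', y)| <= M * `|x - x'|.
Proof.
move=> xs x's yI; wlog xx' : x x' xs x's / x <= x' => [H|].
  have [/H|/ltW yx] := leP x x'; first exact.
  by rewrite distrC [`|x - _|]distrC; apply: H.
move: xx'; rewrite le_eqVlt => /predU1P[->|xx'].
  by rewrite !subrr !normr0 mulr0.
have [c /andP[xc cx'] e] := g_mvt_x xs x's yI xx'.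
rewrite distrC e normrM [`|x - _|]distrC ler_wpM2r//.
by apply: (@dgx_bound s) => //; apply: br_convex xs x's _; rewrite !ltW.
Qed.

Lemma g_lip_y s x y y' : br s x -> Iy y -> Iy y' ->
  `|g (x, y) - g (x, y')| <= `|y - y'| / 2.
Proof.
move=> xs yI y'I; wlog yy' : y y' yI y'I / y <= y' => [H|].
  have [/H|/ltW yx] := leP y y'; first exact.
  by rewrite distrC [`|y - _|]distrC; apply: H.
move: yy'; rewrite le_eqVlt => /predU1P[->|yy'].
  by rewrite !subrr !normr0 mul0r.
have [c /andP[xc cx'] e] := g_mvt_y xs yI y'I yy'.
rewrite distrC e normrM [`|y - _|]distrC mulrC ler_wpM2l//.
rewrite -div1r; apply: (@dgy_bound s) => //.
by move: yI y'I => /IyP yI /IyP y'I; apply/IyP; lra.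
Qed.

Lemma g_lip s x x' y y' : br s x -> br s x' -> Iy y -> Iy y' ->
  `|g (x, y) - g (x', y')| <= M * `|x - x'| + `|y - y'| / 2.
Proof.
move=> xs x's yI y'I; have := g_lip_x xs x's yI; have := g_lip_y x's yI y'I.
have := ler_distD (g (x', y)) (g (x, y)) (g (x', y')); lra.
Qed.

Lemma pair_normlt (a b a' b' d : R) : `|a - a'| < d -> `|b - b'| < d ->
  `|((a, b) : plane) - (a', b')| < d.
Proof. by move=> h1 h2; rewrite prod_normE /= gt_max h1. Qed.

Lemma dgx_cont s x y : br s x -> Iy y -> forall e : R, 0 < e ->
  exists2 d, 0 < d & forall x' y', br s x' -> Iy y' -> `|x' - x| < d ->
    `|y' - y| < d -> `|dgx (x', y') - dgx (x, y)| <= e.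
Proof.
move=> xs yI e e0.
have [|d d0 H] := holder_eps (dgx_holder hL) (x := (x, y)) _ e0.
  by split => //; exact: brU xs.
exists d => // x' y' x's y'I h1 h2; apply: H; last exact: pair_normlt.
by split => //; exact: brU x's.
Qed.

Lemma dgy_cont s x y : br s x -> Iy y -> forall e : R, 0 < e ->
  exists2 d, 0 < d & forall x' y', br s x' -> Iy y' -> `|x' - x| < d ->
    `|y' - y| < d -> `|dgy (x', y') - dgy (x, y)| <= e.
Proof.
move=> xs yI e e0.
have [|d d0 H] := holder_eps (dgy_holder hL) (x := (x, y)) _ e0.
  by split => //; exact: brU xs.
exists d => // x' y' x's y'I h1 h2; apply: H; last exact: pair_normlt.
by split => //; exact: brU x's.
Qed.

(** Joint differentiability from the partial derivatives: move in [x] at height [y'] by the mean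
    value theorem and the continuity of [dgx], then in [y] at abscissa [x]. *)
Lemma g_diff s x y : br s x -> Iy y -> forall e : R, 0 < e ->
  exists2 d, 0 < d & forall x' y', br s x' -> Iy y' -> `|x' - x| < d ->
    `|y' - y| < d ->
    `|g (x', y') - g (x, y) - dgx (x, y) * (x' - x) - dgy (x, y) * (y' - y)|
      <= e * (`|x' - x| + `|y' - y|).
Proof.
move=> xs yI e e0.
have [d1 d10 H1] := dgx_cont xs yI e0.
have [d2 d20 H2] := deriv_within_eps (g_dy hL (brU xs) yI) e0.
exists (Num.min d1 d2); first by rewrite lt_min d10.
move=> x' y' x's y'I; rewrite !lt_min => /andP[xd _] /andP[yd1 yd2].
have A : `|g (x', y') - g (x, y') - dgx (x, y) * (x' - x)| <= e * `|x' - x|.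
  have [xx'|x'x|->] := ltgtP x x'; last first.
  - by rewrite !subrr mulr0 subr0 normr0 mulr0.
  - have [c /andP[xc cx] E] := g_mvt_x x's xs y'I x'x.
    have -> : g (x', y') - g (x, y') = dgx (c, y') * (x' - x).
      by rewrite -opprB E -mulrN opprB.
    rewrite -mulrBl normrM ler_wpM2r//; apply: H1 => //.
      by apply: br_convex x's xs _; rewrite !ltW.
    by move: xd; rewrite !ltr_norml; lra.
  - have [c /andP[xc cx] ->] := g_mvt_x xs x's y'I xx'.
    rewrite -mulrBl normrM ler_wpM2r//; apply: H1 => //.
      by apply: br_convex xs x's _; rewrite !ltW.
    by move: xd; rewrite !ltr_norml; lra.
have B := H2 y' y'I yd2.
rewrite [leRHS]mulrDr; apply: (le_trans _ (lerD A B)).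
apply: (le_trans _ (ler_normD _ _)).
by rewrite le_eqVlt; apply/orP; left; apply/eqP; congr `|_|; ring.
Qed.

End BranchFacts.

(** * Backward orbits and itineraries *)

Section BackwardOrbits.
Context {R : realType} (L : lorenz_data R) (hL : lorenz_map L).
Local Notation plane := (R * R)%type.
Local Notation f := (Defs.f L).
Local Notation g := (Defs.g L).
Local Notation M := (Defs.M L).
Local Notation F := (Defs.F L).
Local Notation Fimg := (Defs.Fimg L).
Local Notation reg := (Defs.Lambda_reg L).

Definition crit_pts : set plane := [set (1, yp L); (-1, ym L)].

Lemma Fval_neq0 (z : plane) : z.1 != 0 -> Fval L z = [set F z].
Proof. by rewrite /Fval => /negPf ->. Qed.

Lemma Fval_eq0 (z : plane) : z.1 = 0 -> Fval L z = crit_pts.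
Proof. by rewrite /Fval => ->; rewrite eqxx. Qed.

Lemma square_br (z : plane) : square z -> z.1 != 0 -> br (z.1 < 0) z.1.
Proof. by move=> /squareP[zI _]; exact: br_of. Qed.

Lemma square_Iy (z : plane) : square z -> Iy z.2.
Proof. by case. Qed.

Lemma F_notcrit (z : plane) : square z -> z.1 != 0 -> ~ crit_pts (F z).
Proof.
move=> sz z0; have := f_strict hL (square_br sz z0).
by rewrite /crit_pts /Defs.F /= => H [[e _]|[e _]]; lra.
Qed.

Lemma F_injective (z w : plane) : F z = F w -> square z -> square w ->
  z.1 != 0 -> w.1 != 0 -> z = w.
Proof.
move=> e sz sw z0 w0; move: e; apply: (F_inj hL); apply: mem_set; split.
- exact/brU/square_br.
- exact: square_Iy.
- exact/brU/square_br.
- exact: square_Iy.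
Qed.

Lemma Fimg_square : Fimg square `<=` square.
Proof. by case: (F_strict hL). Qed.

Lemma crit_square : crit_pts `<=` square.
Proof.
have := yp_bounds hL; have := ym_bounds hL.
by move=> ? ? z [] ->; apply/squareP => /=; lra.
Qed.

Lemma iter_Fimg_square n (A : set plane) :
  A `<=` square -> iter n Fimg A `<=` square.
Proof.
move=> As; elim: n => [//|n IH] z /= [w /IH sw wz].
by apply: Fimg_square; exists w.
Qed.

Lemma reg_square z : reg z -> square z.
Proof. by case => /(_ 0%N I). Qed.

Lemma critical_orbit_crit z : crit_pts z -> critical_orbit L z.
Proof. by move=> cz; exists 0%N. Qed.

(** A preimage on the critical line would make [z] a critical point. The preimages found in the
    successive images of [square] coincide by injectivity of [F], so this single point lies in all
    of them. *)
Lemma reg_pre_ex z : reg z -> exists w, [/\ reg w, w.1 != 0 & F w = z].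
Proof.
move=> [az cz].
have step w : Fval L w z -> w.1 != 0 /\ F w = z.
  have [w0|w0] := eqVneq w.1 0; last by rewrite Fval_neq0// => ->.
  by rewrite Fval_eq0// => /critical_orbit_crit.
have [w sw /step[w0 Fw]] := az 1%N I.
exists w; split => //; split.
  move=> n _; have [w' sw' /step[w'0 Fw']] := az n.+1 I.
  suff -> : w = w' by [].
  apply: F_injective => //; first by rewrite Fw.
  by apply: iter_Fimg_square sw'.
move=> [n _ cw]; apply: cz; exists n.+1 => //; exists w => //.
by rewrite Fval_neq0//= Fw.
Qed.

Lemma reg_F w : reg w -> w.1 != 0 -> reg (F w).
Proof.
move=> [aw cw] w0; have sw : square w by apply: (aw 0%N I).
have FF : Fval L w (F w) by rewrite Fval_neq0.
split.
  move=> [|n] _; first by apply: Fimg_square; exists w.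
  by exists w => //; apply: aw.
move=> [[|n] _]; first exact: F_notcrit.
move=> [v cv]; have [v0|v0] := eqVneq v.1 0.
  by rewrite Fval_eq0// => /F_notcrit; apply.
have sv := iter_Fimg_square crit_square cv.
rewrite Fval_neq0// => /F_injective e; apply: cw; exists n => //.
by rewrite (e sw sv w0 v0).
Qed.

(** The chain puts [zs 0] in every image of [square]. A critical orbit ending at [zs 0] would have
    to follow the chain backward up to a critical point, which [F_notcrit] excludes. This is how
    points with a prescribed itinerary are shown to be regular. *)
Lemma reg_chain (zs : nat -> plane) : (forall n, [/\ square (zs n),
    (zs n.+1).1 != 0 & F (zs n.+1) = zs n]) -> reg (zs 0%N).
Proof.
move=> H.
have chain_val m : Fval L (zs m.+1) (zs m).
  by have [_ z0 e] := H m; rewrite Fval_neq0//= e.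
split.
  move=> n _; elim: n 0%N => [|n IH] m; first by case: (H m).
  by exists (zs m.+1).
move=> [n _]; elim: n 0%N => [|n IH] m /=.
  have [_ z0 <-] := H m; apply: F_notcrit => //; by case: (H m.+1).
move=> [v cv]; have [_ z0 <-] := H m; have [sz _ _] := H m.+1.
have [v0|v0] := eqVneq v.1 0.
  by rewrite Fval_eq0// => /F_notcrit; apply.
rewrite Fval_neq0// => e; apply: (IH m.+1).
have sv := iter_Fimg_square crit_square cv.
by rewrite (F_injective e sz sv z0 v0).
Qed.

(** The default [0] is taken only outside [Lambda_reg]. *)
Definition pre (z : plane) : plane :=
  xget 0 [set w | [/\ reg w, w.1 != 0 & F w = z]].

Lemma preP z : reg z -> [/\ reg (pre z), (pre z).1 != 0 & F (pre z) = z].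
Proof.
by move=> /reg_pre_ex[w]; exact: (@xgetI _ 0 [set w | [/\ reg w, w.1 != 0 & F w = z]]).
Qed.

Lemma pre_reg z : reg z -> reg (pre z). Proof. by case/preP. Qed.
Lemma F_pre z : reg z -> F (pre z) = z. Proof. by case/preP. Qed.

Lemma pre_unique z w : reg z -> square w -> w.1 != 0 -> F w = z -> pre z = w.
Proof.
move=> rz sw w0 Fw; have [rp p0 Fp] := preP rz.
by apply: F_injective => //; [rewrite Fp|exact: reg_square].
Qed.

Lemma pre_F w : reg w -> w.1 != 0 -> pre (F w) = w.
Proof.
by move=> rw w0; apply: pre_unique => //; [exact: reg_F|exact: reg_square].
Qed.

Lemma iter_pre_reg n z : reg z -> reg (iter n pre z).
Proof. by move=> rz; elim: n => //= n; exact: pre_reg. Qed.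

(** Entry [n] concerns the preimage of order [n + 1]: the side of [z] itself is not recorded, since
    [z.1] may vanish. *)
Definition itin (z : plane) (n : nat) : bool := (iter n.+1 pre z).1 < 0.

Lemma itinS z n : itin z n.+1 = itin (pre z) n.
Proof. by rewrite /itin [in LHS]iterSr. Qed.

Lemma itin_pre z z' : itin z = itin z' -> itin (pre z) = itin (pre z').
Proof. by move=> e; apply/funext => n; rewrite -!itinS e. Qed.

Lemma pre_br z : reg z -> br (itin z 0) (pre z).1.
Proof. by move=> /preP[/reg_square sp p0 _]; exact: square_br. Qed.

Lemma itin_F w : reg w -> w.1 != 0 ->
  itin (F w) = fun n => if n is m.+1 then itin w m else (w.1 < 0).
Proof.
by move=> rw w0; apply/funext => -[|n]; rewrite ?itinS /itin /= pre_F.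
Qed.

Lemma pre_f z : reg z -> f (pre z).1 = z.1.
Proof. by move=> rz; rewrite -{2}(F_pre rz). Qed.

Lemma pre_g z : reg z -> g (pre z) = z.2.
Proof. by move=> rz; rewrite -{2}(F_pre rz). Qed.

Lemma reg_bounds z : reg z -> -1 < z.1 < 1.
Proof. by move=> rz; rewrite -(pre_f rz); apply: f_strict (pre_br rz). Qed.

Lemma reg_Iy z : reg z -> Iy z.2.
Proof. by move=> /reg_square; exact: square_Iy. Qed.

Lemma pre_br' z z' : reg z' -> itin z 0 = itin z' 0 -> br (itin z 0) (pre z').1.
Proof. by move=> rz ->; exact: pre_br. Qed.

Lemma pre_dist z z' : reg z -> reg z' -> itin z 0 = itin z' 0 ->
  `|(pre z).1 - (pre z').1| <= `|z.1 - z'.1|.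
Proof.
move=> rz rz' e; rewrite -[z in leRHS](F_pre rz) -[z' in leRHS](F_pre rz').
exact: f_dist hL _ _ _ (pre_br rz) (pre_br' rz' e).
Qed.

(** One step of [F] turns a bound [2 * M] on the slope of chords into [M + (2 * M) / 2], which is
    again [2 * M]; the initial error 2, the height of the square, is halved by each common
    symbol. *)
Lemma reg_lip n z z' : reg z -> reg z' ->
  (forall i, (i < n)%N -> itin z i = itin z' i) ->
  `|z.2 - z'.2| <= 2 * M * `|z.1 - z'.1| + 2 / 2 ^+ n.
Proof.
elim: n z z' => [|n IH] z z' rz rz' e.
  rewrite expr0 divr1.
  have := M_gt0' hL; have := normr_ge0 (z.1 - z'.1).
  have : `|z.2 - z'.2| <= 2.
    by have /IyP := reg_Iy rz; have /IyP := reg_Iy rz'; rewrite ler_norml; lra.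
  set a := `|z.2 - z'.2|; set b := `|z.1 - z'.1|; nra.
have e0 := e 0%N isT.
have := pre_dist rz rz' e0.
have eS i : (i < n)%N -> itin (pre z) i = itin (pre z') i.
  by move=> il; rewrite -!itinS; exact: (e i.+1 il).
have := IH _ _ (pre_reg rz) (pre_reg rz') eS.
have := g_lip hL (pre_br rz) (pre_br' rz' e0) (reg_Iy (pre_reg rz))
  (reg_Iy (pre_reg rz')).
rewrite -!surjective_pairing !pre_g// exprSr invfM mulrA.
have := M_gt0' hL.
set q := 2 / 2 ^+ n; set a := `|z.2 - z'.2|; set b := `|z.1 - z'.1|.
set c := `|_ - _|; set d := `|_ - _|.
move=> m0 H1 H2 H3.
have : M * c <= M * b by rewrite ler_pM2l.
lra.
Qed.

Lemma leaf_lip z z' : reg z -> reg z' -> itin z = itin z' ->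
  `|z.2 - z'.2| <= 2 * M * `|z.1 - z'.1|.
Proof.
move=> rz rz' e; apply: (@le_half_pow _ _ _ 2) => n.
by apply: reg_lip => // i _; rewrite e.
Qed.

Lemma leaf_unique z z' : reg z -> reg z' -> itin z = itin z' -> z.1 = z'.1 ->
  z = z'.
Proof.
move=> rz rz' e e1; have := leaf_lip rz rz' e.
rewrite e1 subrr normr0 mulr0 normr_le0 subr_eq0 => /eqP e2.
by rewrite [z]surjective_pairing e1 e2 -surjective_pairing.
Qed.

(* The inverse of the branch s of f, with value 0 outside dom s. *)
Definition hb (s : bool) (t : R) : R := xget 0 [set x | br s x /\ f x = t].

Lemma hbP s t : dom L s t -> br s (hb s t) /\ f (hb s t) = t.
Proof.
move=> /(f_surj hL)[x xs fx].
exact: (@xgetI _ 0 [set x | br s x /\ f x = t] x (conj xs fx)).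
Qed.

Lemma hb_f s x : br s x -> hb s (f x) = x.
Proof.
move=> xs; have [h1 h2] := hbP (f_dom hL xs); exact: f_inj hL _ _ _ h1 xs h2.
Qed.

Fixpoint hbs (sg : nat -> bool) (t : R) (n : nat) : R :=
  if n is m.+1 then hb (sg m) (hbs sg t m) else t.

(** By [Dom_itin] and [Dom_lift], these [t] are exactly the abscissas of the points of [Lambda_reg]
    with itinerary [sg]. *)
Definition Dom (sg : nat -> bool) (t : R) := forall n, dom L (sg n) (hbs sg t n).

Lemma eq_hbs sg sg' t n : (forall i, (i < n)%N -> sg i = sg' i) ->
  hbs sg t n = hbs sg' t n.
Proof.
by elim: n => //= n IH e; rewrite e// IH// => i /ltnW/e.
Qed.

Lemma hbs_br sg t n : Dom sg t -> br (sg n) (hbs sg t n.+1) /\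
  f (hbs sg t n.+1) = hbs sg t n.
Proof. by move=> D /=; apply: hbP. Qed.

Lemma hbs_itin z n : reg z -> hbs (itin z) z.1 n = (iter n pre z).1.
Proof.
move=> rz; elim: n => //= n ->; have ri := iter_pre_reg n rz.
by rewrite -(pre_f ri) hb_f//; apply: pre_br.
Qed.

Lemma Dom_itin z : reg z -> Dom (itin z) z.1.
Proof.
move=> rz n; rewrite hbs_itin//; have ri := iter_pre_reg n rz.
by rewrite -(pre_f ri); apply: f_dom => //; apply: pre_br.
Qed.

(** The inverse branches prescribe the abscissas of a backward orbit; its ordinates must solve a
    backward system that contracts by [1 / 2], so they exist. *)
Lemma Dom_lift sg t : Dom sg t -> exists z, [/\ reg z, itin z = sg & z.1 = t].
Proof.
move=> D.
have Dbr n := (hbs_br n D).1.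
have IyE y : `|y| <= 1 <-> Iy y :> Prop by rewrite IyP ler_norml.
have [||n y y' /IyE yI /IyE y'I|ys Hys] := @backward_fixed_seq _ 1
    (fun n y => g (hbs sg t n.+1, y)).
- by [].
- by move=> n y /IyE yI; apply/IyE; apply: g_Iy (Dbr n) yI.
- exact: g_lip_y (Dbr n) yI y'I.
pose zs n := (hbs sg t n, ys n).
have zsP n : [/\ square (zs n), (zs n.+1).1 != 0 & F (zs n.+1) = zs n].
  have [/IyE ysI yn] := Hys n; split.
  (* At index 0 the abscissa is [t] itself, bounded because it is a value of a branch of [f]; the
     later ones lie in the domain of a branch. *)
  - split => //=; apply/IyP; case: n {ysI yn} => [|n]; last exact: br_bounds (Dbr n).
    have := f_strict hL (Dbr 0%N); rewrite (hbs_br 0 D).2 /=; lra.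
  - exact: br_neq0 (Dbr n).
  - by rewrite /Defs.F /zs /= -yn; congr (_, _); exact: (hbs_br n D).2.
have regz n : reg (zs n).
  by have := @reg_chain (fun m => zs (m + n)%N); apply=> m; apply: zsP.
have iz n : iter n pre (zs 0%N) = zs n.
  elim: n => //= n ->; have [_ z0 Fz] := zsP n; apply: pre_unique => //.
  exact: reg_square.
exists (zs 0%N); split => //; apply/funext => n.
by rewrite /itin iz /=; apply: br_sign (Dbr n).
Qed.

Lemma Dom_strict sg t : Dom sg t -> -1 < t < 1.
Proof. by move=> /Dom_lift[z [rz _ <-]]; exact: reg_bounds. Qed.

Lemma dom_convex s t u v : dom L s t -> dom L s v -> t <= u <= v -> dom L s u.
Proof. by rewrite !domP; case: s; lra. Qed.

Lemma hb_mono s t u : dom L s t -> dom L s u -> t <= u -> hb s t <= hb s u.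
Proof.
move=> /hbP[b1 e1] /hbP[b2 e2].
by rewrite -{1}e1 -{1}e2 (f_le hL b1 b2).
Qed.

(** Inverse branches are increasing, so successive preimages of [u] stay between those of [t] and
    [v]. *)
Lemma Dom_convex sg t u v : Dom sg t -> Dom sg v -> t <= u <= v -> Dom sg u.
Proof.
move=> Dt Dv tuv.
suff H n : hbs sg t n <= hbs sg u n <= hbs sg v n.
  by move=> n; apply: dom_convex (Dt n) (Dv n) (H n).
elim: n => //= n IH; have du := dom_convex (Dt n) (Dv n) IH.
by case/andP: IH => i1 i2; rewrite !hb_mono.
Qed.

Definition leafpt (sg : nat -> bool) (t : R) : plane :=
  xget 0 [set z | [/\ reg z, itin z = sg & z.1 = t]].

Lemma leafptP sg t : Dom sg t ->
  [/\ reg (leafpt sg t), itin (leafpt sg t) = sg & (leafpt sg t).1 = t].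
Proof.
move=> /Dom_lift[z]; exact: (@xgetI _ 0 [set z | [/\ reg z, itin z = sg & z.1 = t]]).
Qed.

Lemma leafpt_itin z : reg z -> leafpt (itin z) z.1 = z.
Proof.
move=> rz; have [r e e1] := leafptP (Dom_itin rz).
by apply: leaf_unique.
Qed.

End BackwardOrbits.

(** * The unstable line field *)

Section Slopes.
Context {R : realType} (L : lorenz_data R) (hL : lorenz_map L).
Local Notation plane := (R * R)%type.
Local Notation f := (Defs.f L).
Local Notation df := (Defs.df L).
Local Notation dgx := (Defs.dgx L).
Local Notation dgy := (Defs.dgy L).
Local Notation M := (Defs.M L).
Local Notation F := (Defs.F L).
Local Notation DF := (Defs.DF L).
Local Notation reg := (Defs.Lambda_reg L).
Local Notation pre := (pre L).
Local Notation itin := (itin L).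

(** The slope of the image under [DF z] of the line of slope [s]. *)
Definition slope_step (z : plane) (s : R) : R :=
  (dgx z + dgy z * s) / df z.1.

Lemma df_gt s x : br s x -> 4 / 3 < df x.
Proof. by move=> /(df_sqrt hL); apply: lt_le_trans; exact: sqrt2_gt. Qed.

Lemma df_inv s x : br s x -> 0 < (df x)^-1 < 3 / 4.
Proof.
move=> /df_gt H; have d0 : 0 < df x by lra.
by rewrite invr_gt0 d0 /= -[3 / 4]invrK ltf_pV2 ?posrE// ?invr_gt0; lra.
Qed.

Lemma reg_dgx z : reg z -> z.1 != 0 -> `|dgx z| <= M.
Proof.
move=> rz z0; have sz := reg_square rz.
rewrite [z]surjective_pairing; exact: (dgx_bound hL (square_br sz z0) (square_Iy sz)).
Qed.

Lemma reg_dgy z : reg z -> z.1 != 0 -> `|dgy z| <= 1 / 2.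
Proof.
move=> rz z0; have sz := reg_square rz.
rewrite [z]surjective_pairing; exact: (dgy_bound hL (square_br sz z0) (square_Iy sz)).
Qed.

Lemma slope_step_bound z s : reg z -> z.1 != 0 -> `|s| <= 2 * M ->
  `|slope_step z s| <= 2 * M.
Proof.
move=> rz z0 sM; have := reg_dgx rz z0; have := reg_dgy rz z0.
have /andP[d0 d1] := df_inv (square_br (reg_square rz) z0).
rewrite /slope_step normrM [`|_^-1|]gtr0_norm// => by_ ax.
have : `|dgx z + dgy z * s| <= M + 1 / 2 * (2 * M).
  apply: le_trans (ler_normD _ _) _; rewrite normrM lerD//.
  by apply: ler_pM.
have := M_gt0' hL; set A := `|_|; have : 0 <= A by exact: normr_ge0.
move: ((df z.1)^-1) d0 d1 => i; nra.
Qed.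

Lemma slope_step_lip z s s' : reg z -> z.1 != 0 ->
  `|slope_step z s - slope_step z s'| <= `|s - s'| / 2.
Proof.
move=> rz z0; have := reg_dgy rz z0.
have /andP[d0 d1] := df_inv (square_br (reg_square rz) z0).
have -> : slope_step z s - slope_step z s' = dgy z * (s - s') * (df z.1)^-1.
  by rewrite /slope_step; ring.
rewrite !normrM [`|_^-1|]gtr0_norm//.
have := normr_ge0 (s - s'); have := normr_ge0 (dgy z).
move: (`|dgy z|) (`|s - s'|) ((df z.1)^-1) d0 d1 => a b c c0 c1 a0 b0 a1.
have : a * b <= b / 2 by nra.
have : 0 <= a * b by rewrite mulr_ge0.
nra.
Qed.

(** Slopes along the backward orbit that [DF] maps to one another. The bound singles out one
    sequence, because slope steps contract by [1 / 2]. *)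
Definition slope_seq (z : plane) (ss : nat -> R) := forall n,
  `|ss n| <= 2 * M /\ ss n = slope_step (iter n.+1 pre z) (ss n.+1).

Definition slope (z : plane) : R :=
  xget 0 [set s | exists2 ss, slope_seq z ss & ss 0%N = s].

Lemma iter_pre_neq0 n z : reg z -> (iter n.+1 pre z).1 != 0.
Proof. by move=> rz; have [] := preP hL (iter_pre_reg hL n rz). Qed.

Lemma slope_seq_ex z : reg z -> exists ss, slope_seq z ss.
Proof.
move=> rz; apply: (@backward_fixed_seq _ (2 * M) (fun n => slope_step (iter n.+1 pre z))).
- by rewrite mulr_ge0// ltW// M_gt0'.
- move=> n s; apply: slope_step_bound; first exact: iter_pre_reg.
  exact: iter_pre_neq0.
- move=> n s s' _ _; apply: slope_step_lip; first exact: iter_pre_reg.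
  exact: iter_pre_neq0.
Qed.

Lemma slope_seqE z ss : reg z -> slope_seq z ss -> slope z = ss 0%N.
Proof.
move=> rz H; have : [set s | exists2 ss, slope_seq z ss & ss 0%N = s] (slope z).
  by apply: (@xgetI _ 0 [set s | exists2 ss, slope_seq z ss & ss 0%N = s] (ss 0%N)); exists ss.
move=> [ss' H' <-]; apply: (@backward_fixed_unique _ (2 * M)
  (fun n => slope_step (iter n.+1 pre z)) _ _ _ H' H 0%N).
move=> n s s' _ _; apply: slope_step_lip; first exact: iter_pre_reg.
exact: iter_pre_neq0.
Qed.

Lemma slope_bound z : reg z -> `|slope z| <= 2 * M.
Proof.
by move=> rz; have [ss H] := slope_seq_ex rz; rewrite (slope_seqE rz H); case: (H 0%N).
Qed.

Lemma slope_eq z : reg z -> slope z = slope_step (pre z) (slope (pre z)).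
Proof.
move=> rz; have [ss H] := slope_seq_ex rz; rewrite (slope_seqE rz H).
rewrite (@slope_seqE (pre z) (fun n => ss n.+1)); last 2 first.
- exact: pre_reg.
- by move=> n; rewrite -iterSr; exact: (H n.+1).
by case: (H 0%N).
Qed.

Lemma slope_eqM z : reg z ->
  slope z * df (pre z).1 = dgx (pre z) + dgy (pre z) * slope (pre z).
Proof.
move=> rz; rewrite {1}slope_eq// /slope_step divfK//.
have [rp p0 _] := preP hL rz; apply/eqP.
by have := df_gt (square_br (reg_square rp) p0); lra.
Qed.

Definition slope_field (z : plane) : set plane :=
  [set (t, t * slope z) | t in setT].

Lemma slope_field_unstable : is_unstable_field L slope_field.
Proof.
split.
- move=> z _; exists (1, slope z).
    by apply/eqP => -[] /eqP; rewrite oner_eq0.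
  by apply/seteqP; split => [_ [t _ <-]|_ [t _ <-]];
    exists t => //=; rewrite mulr1.
- move=> z rz z0; have rF := reg_F hL rz z0.
  have e : slope (F z) * df z.1 = dgx z + dgy z * slope z.
    by rewrite -{2 3 4 5}(pre_F hL rz z0); apply: slope_eqM.
  have := df_gt (square_br (reg_square rz) z0) => d0.
  have d1 : df z.1 != 0 by apply/eqP; lra.
  apply/seteqP; split => [_ [_ [t _ <-] <-]|_ [t _ <-]].
    exists (df z.1 * t) => //; rewrite /Defs.DF /=; congr (_, _).
    have -> : dgx z * t + dgy z * (t * slope z) = t * (dgx z + dgy z * slope z).
      by ring.
    by rewrite -e; ring.
  exists (t / df z.1, t / df z.1 * slope z); first by exists (t / df z.1).
  rewrite /Defs.DF /=; congr (_, _); first by rewrite mulrC divfK.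
  have -> : slope (F z) = (dgx z + dgy z * slope z) / df z.1 by rewrite -e mulfK.
  by ring.
(* First coordinates shrink by [3 / 4] at each backward step, as [df > 4 / 3]; slopes being at most
   [2 * M], the first coordinate controls the whole vector up to the factor [1 + 2 * M]. *)
- exists (1 + 2 * M), (3 / 4); split; first lra.
  move=> z v Hz Hv n.
  have vE k : v k = ((v k).1, (v k).1 * slope (z k)).
    by have [_ [t _ <-]] := Hz k.
  have M0 := M_gt0' hL.
  have step k : `|(v k).1| <= (3 / 4) ^+ k * `|(v 0%N).1|.
    elim: k => [|k IH]; first by rewrite expr0 mul1r.
    have [z0 _ e] := Hv k; have [rk _] := Hz k.+1.
    have := df_gt (square_br (reg_square rk) z0) => d0.
    have {}e : `|(v k).1| = `|df (z k.+1).1| * `|(v k.+1).1|.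
      by rewrite -e /= normrM.
    rewrite [`|df _|]gtr0_norm in e; last lra.
    rewrite exprS -mulrA; move: IH; rewrite e; move: d0 (normr_ge0 (v k.+1).1).
    move: (df _) `|(v k.+1).1| ((3 / 4) ^+ k * `|(v 0%N).1|) => D a q *; nra.
  have vn : `|v n| <= (1 + 2 * M) * `|(v n).1|.
    rewrite {1}vE prod_normE /= ge_max normrM.
    have := slope_bound (Hz n).1; have := normr_ge0 (v n).1.
    set a := `|_|; set b := `|slope _| => *; apply/andP; split; nra.
  have v0 : `|(v 0%N).1| <= `|v 0%N|.
    by rewrite [leRHS]prod_normE le_max lexx.
  apply: le_trans vn _; rewrite -mulrA ler_pM2l; last lra.
  apply: le_trans (step n) _; rewrite ler_wpM2l// exprn_ge0//; lra.
Qed.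

(** A vector of [E z] is lifted backward inside [E]. Its deviation [d n] from the line of slope
    [slope] satisfies [d n = dgy * d (n + 1)] and is bounded since the lifts are; hence [d 0] is at
    most a constant over [2 ^ n] for every [n], so it vanishes. *)
Lemma unstable_field_unique E z : is_unstable_field L E -> reg z ->
  E z = slope_field z.
Proof.
move=> [Eline EDF [C [lam [/andP[lam0 lam1] Econtr]]]] rz.
(* Both sides are lines, so one inclusion is enough. *)
suff sub : E z `<=` slope_field z.
  have [v v0 vE] := Eline z rz; apply/seteqP; split => // _ [t _ <-].
  have [u _ uv] : slope_field z v.
    by apply: sub; rewrite vE; exists 1 => //; rewrite !mul1r -surjective_pairing.
  rewrite vE; exists (t / u) => //; rewrite -uv /=.
  have u0 : u != 0.
    by apply: contraNneq v0 => u0; rewrite -uv u0 mul0r.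
  by rewrite mulrA divfK.
move=> v Ev.
have lift z' v' : reg z' -> E z' v' -> exists v'', E (pre z') v'' /\ DF (pre z') v'' = v'.
  move=> rz'; have [rp p0 Fp] := preP hL rz'.
  by rewrite -{1}Fp -EDF// => -[v'' Ev'' <-]; exists v''.
pose nxt z' v' := xget 0 [set v'' | E (pre z') v'' /\ DF (pre z') v'' = v'].
have nxtP z' v' : reg z' -> E z' v' -> E (pre z') (nxt z' v') /\ DF (pre z') (nxt z' v') = v'.
  move=> rz' /(lift _ _ rz')[v''].
  exact: (@xgetI _ 0 [set v'' | E (pre z') v'' /\ DF (pre z') v'' = v']).
pose fix vs n := if n is m.+1 then nxt (iter m pre z) (vs m) else v.
have rn n : reg (iter n pre z) by exact: iter_pre_reg.
have vsE n : E (iter n pre z) (vs n).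
  by elim: n => //= n IH; case: (nxtP _ _ (rn n) IH).
have vsD n : DF (iter n.+1 pre z) (vs n.+1) = vs n.
  by case: (nxtP _ _ (rn n) (vsE n)).
have contr n : `|vs n| <= C * lam ^+ n * `|v|.
  apply: (Econtr (fun n => iter n pre z) vs) => // k.
  by have [_ ? ?] := preP hL (rn k).
have M0 := M_gt0' hL.
pose d n := (vs n).2 - slope (iter n pre z) * (vs n).1.
have dS n : d n = dgy (iter n.+1 pre z) * d n.+1.
  have e := slope_eqM (rn n); rewrite /d -(vsD n) /=.
  by rewrite mulrA e; ring.
have d0n n : `|d 0%N| <= `|d n| / 2 ^+ n.
  elim: n => [|n IH]; first by rewrite expr0 divr1.
  apply: le_trans IH _; rewrite exprS invfM mulrA ler_pM2r ?invr_gt0 ?exprn_gt0//.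
  rewrite dS normrM mulrC ler_wpM2l// -div1r.
  exact: (reg_dgy (rn n.+1) (iter_pre_neq0 n rz)).
have dn n : `|d n| <= (1 + 2 * M) * `|vs n|.
  have := slope_bound (rn n).
  have v1 : `|(vs n).1| <= `|vs n| by rewrite [leRHS]prod_normE le_max lexx.
  have v2 : `|(vs n).2| <= `|vs n| by rewrite [leRHS]prod_normE le_max lexx orbT.
  have := ler_normB (vs n).2 (slope (iter n pre z) * (vs n).1).
  rewrite normrM -/(d n) => H1 H2.
  have := ler_pM (normr_ge0 _) (normr_ge0 _) H2 v1; lra.
suff d00 : d 0%N = 0.
  exists v.1 => //; rewrite [RHS]surjective_pairing; congr (_, _).
  by apply/eqP; rewrite mulrC eq_sym -subr_eq0; apply/eqP.
apply/eqP; rewrite -normr_le0.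
apply: (@le_half_pow _ _ _ ((1 + 2 * M) * (`|C| * `|v|))) => n; rewrite add0r.
apply: le_trans (d0n n) _; rewrite ler_pM2r ?invr_gt0 ?exprn_gt0//.
apply: le_trans (dn n) _; rewrite ler_pM2l; last lra.
apply: le_trans (contr n) _; rewrite ler_wpM2r//.
have : lam ^+ n <= 1 by rewrite exprn_ile1// ltW.
have : 0 <= lam ^+ n by rewrite exprn_ge0// ltW.
have := ler_norm C; have := normr_ge0 C; nra.
Qed.

Lemma Eu_slope z : reg z -> Eu L z = slope_field z.
Proof.
apply: unstable_field_unique.
exact: (@xgetI _ _ (is_unstable_field L) _ slope_field_unstable).
Qed.

Lemma f_dist34 s x y : br s x -> br s y -> `|x - y| <= 3 / 4 * `|f x - f y|.
Proof.
move=> xs ys; wlog xy : x y xs ys / x <= y => [H|].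
  have [/H|/ltW yx] := leP x y; first exact.
  by rewrite distrC [X in _ <= _ * X]distrC; apply: H.
have H := f_expand hL xs ys xy; have := @sqrt2_gt R => s2.
rewrite distrC [X in _ <= _ * X]distrC.
have fxy : f x <= f y by rewrite (f_le hL xs ys).
by rewrite !ger0_norm ?subr_ge0//; nra.
Qed.

Lemma pre_dist34 z z' : reg z -> reg z' -> itin z = itin z' ->
  `|(pre z').1 - (pre z).1| <= 3 / 4 * `|z'.1 - z.1|.
Proof.
move=> rz rz' e; rewrite -[z in leRHS](F_pre hL rz) -[z' in leRHS](F_pre hL rz').
apply: f_dist34 (pre_br hL rz') _; rewrite -e; exact: pre_br.
Qed.

Lemma leaf_dist z z' : reg z -> reg z' -> itin z = itin z' ->
  `|z'.2 - z.2| <= 2 * M * `|z'.1 - z.1|.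
Proof. by move=> rz rz' e; apply: leaf_lip. Qed.

(* The estimate holds everywhere with the constant 4 M, and if it holds at the
   preimage of z with the constant e, then it holds at z with e / 2. *)
Lemma leaf_diff z : reg z -> forall e : R, 0 < e -> exists2 d, 0 < d &
  forall z', reg z' -> itin z = itin z' -> `|z'.1 - z.1| < d ->
    `|z'.2 - z.2 - slope z * (z'.1 - z.1)| <= e * `|z'.1 - z.1|.
Proof.
move=> rz e e0; have M0 := M_gt0' hL.
suff H n : exists2 d, 0 < d &
  forall z', reg z' -> itin z = itin z' -> `|z'.1 - z.1| < d ->
    `|z'.2 - z.2 - slope z * (z'.1 - z.1)| <= 4 * M / 2 ^+ n * `|z'.1 - z.1|.
  have [n Hn] := half_pow_small (4 * M) e0; have [d d0 Hd] := H n.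
  exists d => // z' rz' ez zd; apply: le_trans (Hd z' rz' ez zd) _.
  by rewrite ler_wpM2r.
elim: n z rz => [|n IH] z rz.
  exists 1 => // z' rz' ez _; rewrite expr0 divr1.
  have := leaf_dist rz rz' ez; have := slope_bound rz.
  have := ler_normB (z'.2 - z.2) (slope z * (z'.1 - z.1)); rewrite normrM.
  have := normr_ge0 (z'.1 - z.1); set a := `|_|; set b := `|_ - _ - _|; nra.
have [rp p0 Fp] := preP hL rz.
have [d3 d30 Hd3] := IH _ rp.
rewrite exprSr invfM mulrA.
have : 0 < 4 * M / 2 ^+ n by rewrite divr_gt0 ?exprn_gt0//; lra.
move: (4 * M / 2 ^+ n) Hd3 => {}e Hd3 {}e0.
(* With this choice the errors at the preimage add up to at most [(1 / 8 + 1 / 2) * e * |dx|], and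
   [|dx| <= 3 / 4 * |X|] brings this below [e / 2 * |X|]. *)
pose eps := e / (8 * (1 + 4 * M)).
have epsE : eps * (8 * (1 + 4 * M)) = e.
  by rewrite divfK//; apply/eqP; lra.
have eps0 : 0 < eps by rewrite divr_gt0//; lra.
have bp := pre_br hL rz.
have [_ _ fd _ _] := f_diffeo hL (itin z 0).
have [d1 d10 Hd1] := g_diff hL bp (reg_Iy rp) eps0.
have [d2 d20 Hd2] := deriv_within_eps (fd _ bp) eps0.
exists (Num.min (d1 / (1 + 2 * M)) (Num.min d2 d3)).
  by rewrite !lt_min d20 d30 divr_gt0//; lra.
move=> z' rz' ez; rewrite !lt_min => /and3P[zd1 zd2 zd3].
have rp' := pre_reg hL rz'.
have bp' : br (itin z 0) (pre z').1 by rewrite ez; exact: pre_br.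
have ep := itin_pre ez.
have D1 := pre_dist34 rz rz' ez.
have D2 := leaf_dist rp rp' ep.
have a0 := normr_ge0 ((pre z').1 - (pre z).1).
rewrite ltr_pdivlMr in zd1; last lra.
have A := Hd1 _ _ bp' (reg_Iy rp').
have B := Hd2 _ bp'.
have C := Hd3 _ rp' ep.
rewrite -!surjective_pairing !(pre_g hL)// in A.
rewrite !(pre_f hL)// in B.
have zz0 := normr_ge0 (z'.1 - z.1).
have {}A := A ltac:(nra) ltac:(nra).
have {}B := B ltac:(lra).
have {}C := C ltac:(lra).
have sz := slope_bound rz; have se := slope_eqM rz.
have b12 := reg_dgy rp p0.
set dx := (pre z').1 - (pre z).1 in a0 D1 D2 A B C *.
set dy := (pre z').2 - (pre z).2 in D2 A C *.
set X := z'.1 - z.1 in zz0 D1 B *.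
(* The three terms are the linearisation error of [g], the error at the preimage carried by [dgy],
   and the linearisation error of [f] times the slope. *)
have -> : z'.2 - z.2 - slope z * X =
    (z'.2 - z.2 - dgx (pre z) * dx - dgy (pre z) * dy) +
    (dgy (pre z) * (dy - slope (pre z) * dx)) - slope z * (X - df (pre z).1 * dx).
  have -> : slope z * (X - df (pre z).1 * dx) = slope z * X -
      (dgx (pre z) + dgy (pre z) * slope (pre z)) * dx.
    by rewrite mulrBr mulrA se.
  by ring.
apply: le_trans (ler_normB _ _) _.
apply: le_trans (lerD (ler_normD _ _) (lexx _)) _.
rewrite !normrM.
have T2 := ler_pM (normr_ge0 _) (normr_ge0 _) b12 C.
have T3 := ler_pM (normr_ge0 _) (normr_ge0 _) sz B.
apply: le_trans (lerD (lerD A T2) T3) _.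
have e1 : eps * M <= e / 32 by nra.
have T4 : eps * `|dy| <= eps * (2 * M * `|dx|) by rewrite ler_pM2l.
have T5 : (eps + eps * M * 4) * `|dx| = e / 8 * `|dx| by congr (_ * _); lra.
have T6 : e * `|dx| <= e * (3 / 4 * `|X|) by rewrite ler_pM2l.
have T7 : 0 <= e * `|X| by rewrite mulr_ge0// ltW.
lra.
Qed.

(** The scheme of [leaf_diff] again: [4 * M] always bounds the difference, and a bound [e] near the
    preimage gives [e / 2] near the point, by continuity of [df], [dgx] and [dgy]. *)
Lemma slope_cont z : reg z -> forall e : R, 0 < e -> exists2 d, 0 < d &
  forall z', reg z' -> itin z = itin z' -> `|z'.1 - z.1| < d ->
    `|slope z' - slope z| <= e.
Proof.
move=> rz e e0; have M0 := M_gt0' hL.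
suff H n : exists2 d, 0 < d &
  forall z', reg z' -> itin z = itin z' -> `|z'.1 - z.1| < d ->
    `|slope z' - slope z| <= 4 * M / 2 ^+ n.
  have [n Hn] := half_pow_small (4 * M) e0; have [d d0 Hd] := H n.
  by exists d => // z' rz' ez zd; apply: le_trans (Hd z' rz' ez zd) _.
elim: n z rz => [|n IH] z rz.
  exists 1 => // z' rz' ez _; rewrite expr0 divr1.
  have := slope_bound rz; have := slope_bound rz'.
  have := ler_normB (slope z') (slope z); lra.
have [rp p0 Fp] := preP hL rz.
have [d4 d40 Hd4] := IH _ rp.
rewrite exprSr invfM mulrA.
have : 0 < 4 * M / 2 ^+ n by rewrite divr_gt0 ?exprn_gt0//; lra.
move: (4 * M / 2 ^+ n) Hd4 => {}e Hd4 {}e0.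
pose eps := e / (8 * (1 + 4 * M)).
have epsE : eps * (8 * (1 + 4 * M)) = e.
  by rewrite divfK//; apply/eqP; lra.
have eps0 : 0 < eps by rewrite divr_gt0//; lra.
have bp := pre_br hL rz.
have [d1 d10 Hd1] := dgx_cont hL bp (reg_Iy rp) eps0.
have [d2 d20 Hd2] := dgy_cont hL bp (reg_Iy rp) eps0.
have [d3 d30 Hd3] := df_cont hL bp eps0.
exists (Num.min (Num.min d1 d2 / (1 + 2 * M)) (Num.min d3 d4)).
  by rewrite !lt_min d30 d40 divr_gt0 ?lt_min ?d10//; lra.
move=> z' rz' ez; rewrite !lt_min => /and3P[zd1 zd2 zd3].
have rp' := pre_reg hL rz'.
have bp' : br (itin z 0) (pre z').1 by rewrite ez; exact: pre_br.
have ep := itin_pre ez.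
have D1 := pre_dist34 rz rz' ez.
have D2 := leaf_dist rp rp' ep.
have a0 := normr_ge0 ((pre z').1 - (pre z).1).
rewrite ltr_pdivlMr in zd1; last lra.
move: zd1; rewrite lt_min => /andP[zd10 zd12].
have zz0 := normr_ge0 (z'.1 - z.1).
have A := Hd1 _ _ bp' (reg_Iy rp') ltac:(nra) ltac:(nra).
have B := Hd2 _ _ bp' (reg_Iy rp') ltac:(nra) ltac:(nra).
have C := Hd3 _ bp' ltac:(lra).
have D := Hd4 _ rp' ep ltac:(lra).
rewrite -!surjective_pairing in A B.
have sz := slope_bound rz; have sp := slope_bound rp.
have se := slope_eqM rz; have se' := slope_eqM rz'.
have b12 := reg_dgy rp' (br_neq0 bp').
have /andP[i0 i1] := df_inv bp'.
have df0 : df (pre z').1 != 0 by apply/eqP; have := df_gt bp'; lra.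
have -> : slope z' - slope z = ((dgx (pre z') - dgx (pre z)) +
    (dgy (pre z') - dgy (pre z)) * slope (pre z) +
    dgy (pre z') * (slope (pre z') - slope (pre z)) -
    (df (pre z').1 - df (pre z).1) * slope z) * (df (pre z').1)^-1.
  apply: (mulIf df0); rewrite divfK// [LHS]mulrBl se'.
  have -> : (df (pre z').1 - df (pre z).1) * slope z = slope z * df (pre z').1
      - (dgx (pre z) + dgy (pre z) * slope (pre z)) by rewrite -se; ring.
  by ring.
rewrite normrM [`|_^-1|]gtr0_norm//.
set N := `|_ - _ * slope z|.
suff : N <= 5 / 8 * e.
  have N0 : 0 <= N by exact: normr_ge0.
  move: ((df (pre z').1)^-1) i0 i1 => i; nra.
apply: le_trans (ler_normB _ _) _.
apply: le_trans (lerD (ler_normD _ _) (lexx _)) _.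
apply: le_trans (lerD (lerD (ler_normD _ _) (lexx _)) (lexx _)) _.
rewrite !normrM.
have T2 := ler_pM (normr_ge0 _) (normr_ge0 _) b12 D.
have T3 := ler_pM (normr_ge0 _) (normr_ge0 _) B sp.
have T4 := ler_pM (normr_ge0 _) (normr_ge0 _) C sz.
lra.
Qed.

End Slopes.

(** * Itineraries are locally constant, and the sets Lambda_n are compact *)

Section Topology.
Context {R : realType} (L : lorenz_data R) (hL : lorenz_map L).
Local Notation plane := (R * R)%type.
Local Notation f := (Defs.f L).
Local Notation g := (Defs.g L).
Local Notation M := (Defs.M L).
Local Notation F := (Defs.F L).
Local Notation reg := (Defs.Lambda_reg L).
Local Notation pre := (pre L).
Local Notation itin := (itin L).
Local Notation Dom := (Dom L).

Lemma plane_cvgP {T : Type} (G : set_system T) (FG : Filter G) (a : T -> plane)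
    (w : plane) : a @ G --> w <->
  forall e : R, 0 < e -> \forall t \near G, `|(a t).1 - w.1| < e /\ `|(a t).2 - w.2| < e.
Proof.
split.
  move=> /cvgrPdist_lt H e e0; apply: filterS (H e e0) => t.
  by rewrite prod_normE /= gt_max distrC [in X in _ && X]distrC => /andP.
move=> H; apply/cvgrPdist_lt => e e0; apply: filterS (H e e0) => t [h1 h2].
by rewrite prod_normE /= gt_max distrC h1 distrC h2.
Qed.

Lemma near_same_branch {T : Type} (G : set_system T) (FG : Filter G)
    (a : T -> plane) (w : plane) : a @ G --> w -> square w -> w.1 != 0 ->
  (\forall t \near G, square (a t)) ->
  \forall t \near G, br (w.1 < 0) (a t).1 /\ square (a t).
Proof.
move=> /(plane_cvgP FG) aw sw w0 sa.
have w0' : 0 < `|w.1| by rewrite normr_gt0.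
apply: filterS2 sa (aw _ w0') => t st [h _]; split => //.
have a0 : (a t).1 != 0.
  by apply: contraTneq h => ->; rewrite sub0r normrN ltxx.
have := square_br st a0; suff -> : ((a t).1 < 0) = (w.1 < 0) by [].
move: h; rewrite ltr_norml; have [wn|wp] := ltP w.1 0.
  by rewrite (ltr0_norm wn) => /andP[_ h]; apply/idP; lra.
by rewrite (ger0_norm wp) => /andP[h _]; apply/negP; lra.
Qed.

Lemma F_cvg {T : Type} (G : set_system T) (FG : Filter G)
    (a : T -> plane) (w : plane) : a @ G --> w -> square w -> w.1 != 0 ->
  (\forall t \near G, square (a t)) -> (F \o a) @ G --> F w.
Proof.
move=> aw sw w0 sa; have nb := near_same_branch FG aw sw w0 sa.
have bw := square_br sw w0; have M0 := M_gt0' hL.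
apply/(plane_cvgP FG) => e e0.
have e20 : 0 < e / 2 by lra.
have [d d0 Hd] := f_cont hL bw e20.
have e2 : 0 < e / (1 + M) by rewrite divr_gt0//; lra.
have aw' := (plane_cvgP FG _ _).1 aw.
apply: filterS3 nb (aw' d d0) (aw' _ e2) =>  t [bt st] [h1 _] [h2 h3].
split; rewrite /Defs.F /=.
  by apply: le_lt_trans (Hd _ bt h1) _; lra.
have := g_lip hL bt bw (square_Iy st) (square_Iy sw).
rewrite -!surjective_pairing; rewrite !ltr_pdivlMr in h2 h3; try lra.
have := normr_ge0 ((a t).1 - w.1); have := normr_ge0 ((a t).2 - w.2).
move=> ? ? H; apply: le_lt_trans H _; nra.
Qed.

Definition crit_pt (s : bool) : plane := if s then (1, yp L) else (-1, ym L).

Lemma F_cvg_crit {T : Type} (s : bool) (G : set_system T) (FG : Filter G)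
    (a : T -> plane) (w : plane) : a @ G --> w -> square w -> w.1 = 0 ->
  (\forall t \near G, square (a t)) -> (\forall t \near G, br s (a t).1) ->
  (F \o a) @ G --> crit_pt s.
Proof.
move=> aw sw w0 sa ba.
have /cvgrPdist_lt gc : (g \o a) @ G --> (crit_pt s).2.
  have wE : w = (0, w.2) by rewrite {1}[w]surjective_pairing w0.
  have aI D : (\forall t \near G, D (a t)) -> a @ G --> within D (nbhs w).
    by move=> H V; rewrite /within /= nbhs_simpl => /aw H'; apply: filterS2 H H' => t + h; exact: h.
  case: s ba => ba.
    apply: cvg_comp (g_0left hL (square_Iy sw)); rewrite -wE; apply: aI.
    by apply: filterS2 sa ba => t [_ ?]; split.
  apply: cvg_comp (g_0right hL (square_Iy sw)); rewrite -wE; apply: aI.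
  by apply: filterS2 sa ba => t [_ ?]; split.
have aw' := (plane_cvgP FG _ _).1 aw.
have := vl_bounds hL; have := vr_bounds hL => vrb vlb.
apply/(plane_cvgP FG) => e e0.
(* A value of the branch within [e] of its limit at 0. By monotonicity, points between its preimage
   [x0] and 0 have images at least as close to this limit. *)
pose t0 := if s then Num.max (vl L) (1 - e) else Num.min (vr L) (-1 + e).
have [x0 bx0 fx0] : exists2 x, br s x & f x = t0.
  apply: (f_surj hL); apply/domP; rewrite /t0; case: s {ba gc t0}.
    by rewrite le_max lexx /= gt_max; lra.
  by rewrite ge_min lexx /= lt_min; lra.
have x00 : 0 < `|x0| by rewrite normr_gt0; exact: br_neq0 bx0.
apply: filterS3 ba (aw' _ x00) (gc e e0) => t bt [h _]; rewrite w0 subr0 in h.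
rewrite distrC => ge; split; last by case: s {gc t0 fx0 bx0 bt} ge.
have fb := f_strict hL bt; rewrite /Defs.F /= {ge gc}.
rewrite {}/t0 in fx0; case: s fx0 bx0 bt => fx0 bx0 bt.
  move: (bt) (bx0) => /brP bt' /brP bx'.
  rewrite ltr0_norm in h; last lra; rewrite [`|x0|]ltr0_norm in h; last lra.
  have : f x0 < f (a t).1 by rewrite (f_lt hL bx0 bt); lra.
  by rewrite fx0 gt_max ltr_norml /= => /andP[_ H]; lra.
move: (bt) (bx0) => /brP bt' /brP bx'.
rewrite gtr0_norm in h; last lra; rewrite [`|x0|]gtr0_norm in h; last lra.
have : f (a t).1 < f x0 by rewrite (f_lt hL bt bx0); lra.
by rewrite fx0 lt_min ltr_norml /= => /andP[_ H]; lra.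
Qed.

(** An ultrafilter decides on which side of 0 the points lie, so their images converge even when [w]
    is on the critical line, to one of the two values there. *)
Lemma F_cvg_ultra {T : Type} (G : set_system T) (a : T -> plane) (w : plane) :
  UltraFilter G -> a @ G --> w -> square w ->
  (\forall t \near G, square (a t) /\ (a t).1 != 0) ->
  exists2 z, Fval L w z & (F \o a) @ G --> z.
Proof.
move=> GU aw sw sa.
have sa1 : \forall t \near G, square (a t) by apply: filterS sa => t [].
have [w0|w0] := eqVneq w.1 0; last first.
  by exists (F w); [rewrite Fval_neq0|exact: F_cvg].
rewrite Fval_eq0//.
have [H|H] := in_ultra_setVsetC [set t | (a t).1 < 0] GU.
  exists (1, yp L); first by left.
  apply: (@F_cvg_crit _ true _ _ _ _ aw) => //.
  by apply: filterS2 sa H => t [st t0] tn; have := square_br st t0; rewrite (tn : _ < _ = true).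
exists (-1, ym L); first by right.
apply: (@F_cvg_crit _ false _ _ _ _ aw) => //.
apply: filterS2 sa H => t [st t0] /negP/negbTE tn.
by have := square_br st t0; rewrite tn.
Qed.

Lemma square_compact : compact (@square R).
Proof. by apply: compact_setX; exact: segment_compact. Qed.

Lemma ultra_cvg_unique {T : Type} (G : set_system T) (a : T -> plane)
    (z z' : plane) : UltraFilter G -> a @ G --> z -> a @ G --> z' -> z = z'.
Proof.
by move=> GU az az'; apply: (norm_cvg_unique (F := a @ G)).
Qed.

(** Compactness of [square] gives a limit to the preimages of each order; these limits form a
    backward orbit of the bi-valued map, which may meet the critical line. *)
Lemma reg_limit {T : Type} (G : set_system T) (a : T -> plane) (z : plane) :
  UltraFilter G -> (\forall t \near G, reg (a t)) -> a @ G --> z ->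
  exists zs : nat -> plane, zs 0%N = z /\ forall n, [/\ square (zs n),
    Fval L (zs n.+1) (zs n) & (fun t => iter n pre (a t)) @ G --> zs n].
Proof.
move=> GU ra az.
have rn n : \forall t \near G, reg (iter n pre (a t)).
  by apply: filterS ra => t; exact: iter_pre_reg.
have /choice[zs Hzs] : forall n, exists w, square w /\
    (fun t => iter n pre (a t)) @ G --> w.
  move=> n; have [|p sp cp] := @ultra_compact_cvg _ _ G _
    (fun t => iter n pre (a t)) GU square_compact; last by exists p.
  by apply: filterS (rn n) => t; exact: reg_square.
exists zs; split; first by apply: (ultra_cvg_unique GU (Hzs 0%N).2).
move=> n; have [sz cz] := Hzs n; split => //; have [sz' cz'] := Hzs n.+1.
have [|w Fw cw] := F_cvg_ultra GU cz' sz'.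
  apply: filterS (rn n) => t /(preP hL)[rt t0 _]; split => //.
  exact: reg_square rt.
suff -> : zs n = w by [].
apply: (ultra_cvg_unique GU cz); apply: cvg_trans cw.
apply: near_eq_cvg; apply: filterS (rn n) => t /(F_pre hL) /= e.
by rewrite e.
Qed.

Lemma reg_limit_attractor {T : Type} (G : set_system T) (a : T -> plane)
    (z : plane) : UltraFilter G -> (\forall t \near G, reg (a t)) ->
  a @ G --> z -> attractor L z.
Proof.
move=> GU ra az; have [zs [<- H]] := reg_limit GU ra az.
move=> n _; elim: n 0%N => [|n IH] m; first by case: (H m).
by exists (zs m.+1) => //; case: (H m).
Qed.

(** For a regular limit the orbit of [reg_limit] cannot meet the critical line, hence is the
    backward orbit of [z]: iterates of [pre] are continuous on [Lambda_reg]. *)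
Lemma pre_ultra {T : Type} (G : set_system T) (a : T -> plane) (z : plane) n :
  UltraFilter G -> (\forall t \near G, reg (a t)) -> a @ G --> z -> reg z ->
  (fun t => iter n pre (a t)) @ G --> iter n pre z.
Proof.
move=> GU ra az rz; have [zs [e0 H]] := reg_limit GU ra az.
suff e k : zs k = iter k pre z by rewrite -e; case: (H n).
elim: k => //= k IH; have rk := iter_pre_reg hL k rz.
have [_ + _] := H k; have [sk _ _] := H k.+1; rewrite IH.
have [k0|k0] := eqVneq (zs k.+1).1 0.
  by rewrite Fval_eq0// => /critical_orbit_crit ck; case: rk.
by rewrite Fval_neq0//= => Fk; rewrite (pre_unique hL rk sk k0).
Qed.

(** Otherwise some ultrafilter of regular points with another [k]-th symbol converges to [z]. Their
    preimages converge to that of [z], which is off the critical line, so the sides eventually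
    agree. *)
Lemma itin_near z k : reg z -> \forall z' \near z, reg z' -> itin z' k = itin z k.
Proof.
move=> rz; apply: contrapT => H.
pose B := [set z' | reg z' /\ itin z' k <> itin z k].
have PB : ProperFilter (within B (nbhs z)).
  apply: Build_ProperFilter_ex => V; rewrite /within /= => HV.
  apply: contrapT => nV; apply: H; apply: filterS HV => z' hz' rz'.
  by apply: contrapT => ne; apply: nV; exists z'; apply: hz'.
have [G [GU sG]] := ultraFilterLemma PB.
have GB : G B by apply: sG; exact: withinT.
have Gz : G --> z by move=> V Vz; apply: sG; exact: filterS Vz.
have Gr : \forall t \near G, reg (idfun t) by apply: filterS GB => t [].
have c := pre_ultra (n := k.+1) (a := idfun) GU Gr Gz rz.
have rk := iter_pre_reg hL k.+1 rz.
have H1 : \forall t \near G, br ((iter k.+1 pre z).1 < 0) (iter k.+1 pre t).1 /\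
    square (iter k.+1 pre t).
  apply: (near_same_branch (a := fun t => iter k.+1 pre t) _ c).
  - exact: reg_square rk.
  - by have [] := preP hL (iter_pre_reg hL k rz).
  - by apply: filterS Gr => t rt; exact: reg_square (iter_pre_reg hL k.+1 rt).
have [t [[bt _] [_]]] := filter_ex (filterI H1 GB).
by apply; exact: br_sign bt.
Qed.

(** The two values of each symbol split [C] into disjoint relatively open parts. *)
Lemma connected_itin (C : set plane) z z' : connected C -> C `<=` reg -> C z ->
  C z' -> itin z' = itin z.
Proof.
move=> cC sC Cz Cz'; apply/funext => k.
(* [itin_near] controls regular points only; the implication admits all the others, so that the
   interior contains the points of [C] with symbol [b]. *)
pose O b : set plane := [set w | reg w -> itin w k = b]°.
have OP b w : C w -> (O b w <-> itin w k = b).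
  move=> Cw; split => [/interior_subset|]; first by apply; exact: sC.
  by move=> <-; apply: itin_near; exact: sC.
have CO : C `&` O (itin z k) = C.
  apply: cC.
  - by exists z; split => //; apply/OP.
  - by exists (O (itin z k)) => //; exact: open_interior.
  - exists (~` O (~~ itin z k)); first exact/open_closedC/open_interior.
    apply/seteqP; split => w [Cw].
      by move=> /(OP _ _ Cw) e; split => // /(OP _ _ Cw); rewrite e; case: itin.
    move=> e; split => //; apply/OP => //; apply: contrapT => ne; apply: e.
    by apply/OP => //; move: ne; case: (itin w k); case: (itin z k).
by have [_ /(OP _ _ Cz')] : (C `&` O (itin z k)) z' by rewrite CO.
Qed.

(** * The sets Lambda_n and their compactness *)

Definition has_leaf (e : R) (z : plane) : Prop :=
  reg z /\ forall t, `|t - z.1| < e -> Dom (itin z) t.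

Definition Lam (n : nat) : set plane := has_leaf n.+1%:R^-1.

(** The ultrafilter selects a limit itinerary [sg], whose leaf is defined around [z.1]; the point of
    this leaf above [z.1] is shown to be [z], which makes [z] regular. *)
Lemma has_leaf_closed (G : set_system plane) (e : R) (z : plane) :
  0 < e -> UltraFilter G -> G (has_leaf e) -> G --> z -> has_leaf e z.
Proof.
move=> e0 GU GH Gz; have M0 := M_gt0' hL.
have FG : Filter G by exact: _.
pose sg k := `[< G [set w | itin w k] >].
have sgP k : G [set w | itin w k = sg k].
  rewrite /sg; have [H|H] := in_ultra_setVsetC [set w | itin w k] GU.
    by rewrite asboolT//; apply: filterS H => w ->.
  rewrite asboolF; first by apply: filterS H => w /negP/negbTE.
  by move=> H'; have [w [h /=]] := filter_ex (filterI H' H); apply.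
have sgN N : G [set w | forall i, (i < N)%N -> itin w i = sg i].
  elim: N => [|N IH]; first exact: filterE.
  apply: filterS2 IH (sgP N) => w h1 h2 i; rewrite ltnS leq_eqVlt.
  by move=> /predU1P[->//|]; exact: h1.
have Gz' := (@plane_cvgP _ G FG idfun z).1 Gz.
have Dt t : `|t - z.1| < e -> Dom sg t.
  (* As the inequality is strict, [t] is still within [e] of [w.1] when [w] is close to [z]; the
     first [k + 1] symbols of [w] can be taken equal to those of [sg]. *)
  move=> tz k; have d0 : 0 < e - `|t - z.1| by rewrite subr_gt0.
  have [w [[[_ hw] hi] [h1 _]]] := filter_ex (filterI (filterI GH (sgN k.+1)) (Gz' _ d0)).
  have tw : `|t - w.1| < e.
    by have := ler_distD z.1 t w.1; rewrite [`|z.1 - _|]distrC; lra.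
  have := hw t tw k; rewrite hi//.
  by rewrite (@eq_hbs _ _ _ sg)// => i /ltnW; exact: hi.
have Dz : Dom sg z.1 by apply: Dt; rewrite subrr normr0.
have [rz0 iz0 z01] := leafptP hL Dz.
suff e2 : (leafpt L sg z.1).2 = z.2.
  suff -> : z = leafpt L sg z.1 by split; rewrite ?iz0 ?z01.
  by rewrite [RHS]surjective_pairing z01 e2 -surjective_pairing.
set z0 := leafpt L sg z.1 in rz0 iz0 z01 *.
apply/eqP; rewrite eq_sym -subr_eq0 -normr_le0.
(* Of the constant 3, 2 comes from [reg_lip] with [N] common symbols and 1 from the distance between
   [w] and [z]. *)
apply: (@le_half_pow _ _ _ 3) => N; rewrite add0r.
have d0 : 0 < (2 ^+ N)^-1 / (1 + 2 * M).
  by rewrite divr_gt0 ?invr_gt0 ?exprn_gt0//; lra.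
have [w [[[rw _] hi] [h1 h2]]] := filter_ex (filterI (filterI GH (sgN N)) (Gz' _ d0)).
have := @reg_lip _ _ hL N w z0 rw rz0; rewrite iz0 => /(_ hi); rewrite z01.
have := ler_distD w.2 z.2 z0.2; rewrite [`|z.2 - w.2|]distrC.
rewrite !ltr_pdivlMr in h1 h2; try lra.
have := normr_ge0 (w.1 - z.1); have := normr_ge0 (w.2 - z.2).
move: h1 h2; rewrite /idfun; move: (`|w.1 - z.1|) (`|w.2 - z.2|) (2 ^+ N)^-1.
move=> a b c; nra.
Qed.

Lemma Lam_compact n : compact (Lam n).
Proof.
rewrite compact_ultra => G GU GL.
have [|z _ Gz] := ultra_compact_cvg GU square_compact (a := idfun).
  by apply: filterS GL => z [/reg_square].
by exists z; split => //; apply: has_leaf_closed GU GL Gz; rewrite invr_gt0.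
Qed.

Lemma Lam_mono n : Lam n `<=` Lam n.+1.
Proof.
move=> z [rz H]; split => // t h; apply: H; apply: lt_le_trans h _.
by rewrite lef_pV2 ?posrE// ler_nat.
Qed.

Lemma Lam_attractor n : Lam n `<=` attractor L.
Proof. by move=> z [[]]. Qed.

Lemma bigcup_LamP z : (\bigcup_n Lam n) z <-> exists2 e, 0 < e & has_leaf e z.
Proof.
split => [[n _ H]|[e e0 [rz H]]]; first by exists n.+1%:R^-1 => //; rewrite invr_gt0.
exists (Num.truncn e^-1) => //; split => // t h; apply: H.
apply: lt_le_trans h _; rewrite invf_ple ?posrE//.
exact: ltW (truncnS_gt _).
Qed.

Lemma closure_reg_attractor (A : set plane) :
  A `<=` reg -> closure A `<=` attractor L.
Proof.
move=> sA z clA.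
have PA : ProperFilter (within A (nbhs z)).
  apply: Build_ProperFilter_ex => V; rewrite /within /= => /clA[w [Aw h]].
  by exists w; exact: h.
have [G [GU sG]] := ultraFilterLemma PA.
have GA : G A by apply: sG; exact: withinT.
apply: (@reg_limit_attractor _ G idfun _ GU); first exact: filterS sA GA.
by move=> V Vz; apply: sG; exact: filterS Vz.
Qed.

End Topology.

(** * Iterates of intervals under f *)

Section OneDimensional.
Context {R : realType} (L : lorenz_data R) (hL : lorenz_map L).
Local Notation f := (Defs.f L).
Local Notation df := (Defs.df L).
Local Notation F := (Defs.F L).
Local Notation reg := (Defs.Lambda_reg L).
Local Notation pre := (pre L).
Local Notation itin := (itin L).
Local Notation Dom := (Dom L).
Local Notation hbs := (hbs L).
Local Notation hb := (hb L).
Local Notation dom := (dom L).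
Local Notation U := (\bigcup_n Lam L n).

(** * Covering relations between intervals *)

Lemma hbs_add sg t p n :
  hbs sg t (p + n)%N = hbs (fun k => sg (p + k)%N) (hbs sg t p) n.
Proof. by elim: n => [|n IH]; rewrite ?addn0// addnS /= IH. Qed.

Lemma Dom_add p sg t : (forall n, (n < p)%N -> dom (sg n) (hbs sg t n)) ->
  Dom (fun k => sg (p + k)%N) (hbs sg t p) -> Dom sg t.
Proof.
move=> H D n; have [np|pn] := ltnP n p; first exact: H.
by have := D (n - p)%N; rewrite -hbs_add subnKC.
Qed.

Lemma Dom_hb sg t : Dom sg t -> Dom (fun n => sg n.+1) (hb (sg 0%N) t).
Proof.
move=> D n; have := D n.+1; suff -> : hbs sg t n.+1 =
  hbs (fun n => sg n.+1) (hb (sg 0%N) t) n by [].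
exact: (hbs_add sg t 1 n).
Qed.

(** A single leaf lies over the whole of []a, b[]. *)
Definition good (a b : R) := exists sg, forall t, a < t < b -> Dom sg t.

(** In other words, one branch of the [p]-th iterate of [f] carries a part of []a, b[] onto []a',
    b'[]. The symbols are read backward in time, starting from the target. *)
Definition covers p sg (a b a' b' : R) := forall t, a' < t < b' ->
  (forall n, (n < p)%N -> dom (sg n) (hbs sg t n)) /\ a < hbs sg t p < b.

Definition splice p (sg sg' : nat -> bool) (n : nat) : bool :=
  if (n < p)%N then sg n else sg' (n - p)%N.

Lemma splice_shift p sg sg' : (fun k => splice p sg sg' (p + k)%N) = sg'.
Proof.
by apply/funext => k; rewrite /splice ltnNge leq_addr /= addKn.
Qed.

Lemma splice_hbs p sg sg' t n : (n <= p)%N ->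
  hbs (splice p sg sg') t n = hbs sg t n.
Proof.
by move=> np; apply: eq_hbs => i ni; rewrite /splice (leq_trans ni np).
Qed.

(** The leaf over []a, b[] is pushed forward by the branch, which prepends [p] symbols of [sg] to
    its itinerary. *)
Lemma covers_good p sg a b a' b' : covers p sg a b a' b' -> good a b ->
  good a' b'.
Proof.
move=> H [sg0 G]; exists (splice p sg sg0) => t /H[H1 H2].
apply: (@Dom_add p) => [n np|].
  by rewrite splice_hbs 1?ltnW// /splice np; exact: H1.
by rewrite splice_shift splice_hbs//; exact: G.
Qed.

Lemma covers_trans p sg p' sg' a b a' b' a'' b'' : covers p sg a b a' b' ->
  covers p' sg' a' b' a'' b'' ->
  covers (p' + p) (splice p' sg' sg) a b a'' b''.
Proof.
move=> H H' t /H'[H1 /H[H2 H3]].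
rewrite hbs_add splice_shift splice_hbs//; split => // n np.
have [np'|p'n] := ltnP n p'.
  by rewrite splice_hbs 1?ltnW// /splice np'; exact: H1.
rewrite -(subnKC p'n) hbs_add splice_shift splice_hbs//.
rewrite /splice ltnNge leq_addr /= addKn; apply: H2.
by rewrite ltn_subLR.
Qed.

(** The inverse branch maps the interval into itself, so it can be iterated forever. *)
Lemma covers_periodic p sg a b : (0 < p)%N -> covers p sg a b a b -> good a b.
Proof.
move=> p0 H; exists (fun n => sg (n %% p)%N).
have hs t n : (n <= p)%N -> hbs (fun n => sg (n %% p)%N) t n = hbs sg t n.
  by move=> np; apply: eq_hbs => i ni; rewrite modn_small// (leq_trans ni).
move=> t tab n; elim/ltn_ind: n t tab => n IH t tab; have [H1 H2] := H t tab.
have [np|pn] := ltnP n p; first by rewrite hs 1?ltnW// modn_small//; exact: H1.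
rewrite -(subnKC pn) hbs_add hs// modnDl.
have -> : (fun k => sg ((p + k) %% p)%N) = (fun k => sg (k %% p)%N).
  by apply/funext => k; rewrite modnDl.
by apply: IH => //; rewrite ltn_subrL p0 (leq_trans p0 pn).
Qed.

Lemma covers_sub p sg a b a' b' c d c' d' : covers p sg a b a' b' ->
  c <= a -> b <= d -> a' <= c' -> d' <= b' -> covers p sg c d c' d'.
Proof.
move=> H ca bd ac db t tcd; have [|H1 H2] := H t; last by split => //; lra.
lra.
Qed.

Lemma covers_branch s (a b a' b' : R) :
  (forall t, a' < t < b' -> dom s t) ->
  (forall x, br s x -> a' < f x < b' -> a < x < b) ->
  covers 1 (fun=> s) a b a' b'.
Proof.
move=> Hd Hx t tab; split; first by case=> //= _; exact: Hd.
by have [h1 h2] := hbP hL (Hd t tab); apply: Hx => //=; rewrite h2.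
Qed.

Lemma f1E : f 1 = vr L.
Proof.
have b1 : br false (1 : R) by apply/brP; lra.
have [|x xb fx] := @f_surj _ _ hL false (vr L).
  by apply/domP; have := vr_bounds hL; lra.
have /domP := f_dom hL b1; have : f x <= f 1.
  by rewrite (f_le hL xb b1); move/brP : xb; lra.
by rewrite fx => ? ?; apply/eqP; lra.
Qed.

Lemma fN1E : f (-1) = vl L.
Proof.
have b1 : br true (-1 : R) by apply/brP; lra.
have [|x xb fx] := @f_surj _ _ hL true (vl L).
  by apply/domP; have := vl_bounds hL; lra.
have /domP := f_dom hL b1; have : f (-1) <= f x.
  by rewrite (f_le hL b1 xb); move/brP : xb; lra.
by rewrite fx => ? ?; apply/eqP; lra.
Qed.

Lemma covers_right0 b : 0 < b <= 1 -> covers 1 (fun=> false) 0 b (-1) (f b).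
Proof.
move=> b01; have bb : br false b by apply/brP.
have /domP fb := f_dom hL bb; apply: covers_branch => [t tb|x xb fx].
  by apply/domP; lra.
move: (xb) => /brP; have := f_lt hL xb bb; case: (x < b); lra.
Qed.

Lemma covers_left0 a : -1 <= a < 0 -> covers 1 (fun=> true) a 0 (f a) 1.
Proof.
move=> b01; have bb : br true a by apply/brP.
have /domP fb := f_dom hL bb; apply: covers_branch => [t tb|x xb fx].
  by apply/domP; lra.
move: (xb) => /brP; have := f_lt hL bb xb; case: (a < x); lra.
Qed.

Lemma covers_br s a b : br s a -> br s b ->
  covers 1 (fun=> s) a b (f a) (f b).
Proof.
move=> ba bb; apply: covers_branch => [t tb|x xb fx].
  apply: (dom_convex (f_dom hL ba) (f_dom hL bb)); lra.
by rewrite -(f_lt hL ba xb) -(f_lt hL xb bb).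
Qed.

(** * Growth of intervals under iteration *)

Lemma sqrt2_lt : Num.sqrt (2 : R) < 3 / 2.
Proof.
have -> : 3 / 2 = Num.sqrt ((3 / 2 : R) ^+ 2) by rewrite sqrtr_sqr ger0_norm//; lra.
by rewrite ltr_sqrt; lra.
Qed.

Lemma df_steep : exists2 r0, 0 < r0 <= 1 & forall s x, br s x -> `|x| < r0 ->
  3 <= df x.
Proof.
have [rho /andP[rho0 rho1] H] := df_near0 hL.
have q0 : 0 < 1 - rho by lra.
move: H; rewrite near_withinE => /nbhs_ballP[d /= d0 Hd].
(* The radius at which [|x|] to the power [1 - rho] equals [1 / 3]; closer to 0 the derivative is at
   least 3. *)
pose r1 := (1 / 3 : R) `^ (1 - rho)^-1.
have r10 : 0 < r1 by rewrite powR_gt0.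
exists (Num.min d (Num.min r1 1)).
  by rewrite !lt_min d0 r10 ltr01 /= !ge_min lexx !orbT.
move=> s x bx; rewrite !lt_min => /and3P[xd xr _].
have x0 := br_neq0 bx.
rewrite (Hd x)//; last by rewrite /ball /= sub0r normrN.
have P3 : `|x| `^ (1 - rho) <= 1 / 3.
  have -> : 1 / 3 = r1 `^ (1 - rho).
    by rewrite -powRrM mulVf ?lt0r_neq0// powRr1.
  by apply: ge0_ler_powR; rewrite ?nnegrE ?powR_ge0// ltW.
have p0 : 0 < `|x| `^ (1 - rho) by rewrite powR_gt0// normr_gt0.
rewrite ler_pdivlMr//; lra.
Qed.

Lemma steep_expand r0 s x y : (forall s x, br s x -> `|x| < r0 -> 3 <= df x) ->
  br s x -> br s y -> `|x| < r0 -> `|y| < r0 -> x < y ->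
  3 * (y - x) <= f y - f x.
Proof.
move=> H bx b_y xr yr xy; have [c /andP[xc cy] ->] := f_mvt hL bx b_y xy.
rewrite ler_wpM2r ?subr_ge0 ?(ltW xy)//; apply: (H s).
  by apply: br_convex bx b_y _; rewrite !ltW.
by move: xr yr; rewrite !ltr_norml; lra.
Qed.

(** An interval ending at 0 has a part where [f' >= 3], so its length grows by a factor above
    [sqrt 2], uniformly. The quantities [f b + 1] and [1 - f a] are the lengths of the images of
    []0, b[] and []a, 0[]. *)
Lemma cut_expand : exists2 k : R, 1 < k <= 4 / 3 &
  (forall b, 0 < b <= 1 -> Num.sqrt 2 * k * b <= f b + 1) /\
  (forall a, -1 <= a < 0 -> Num.sqrt 2 * k * - a <= 1 - f a).
Proof.
have [r0 r01 H] := df_steep; exists (1 + r0 / 3); first lra.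
have s1 := @sqrt2_gt R; have s2 := sqrt2_lt.
have nearR b : 0 < b < r0 -> 3 * b <= f b + 1.
  move=> br0; apply/ler_addgt0Pr => e e0.
  (* The limit [-1] at 0 is not a value of the right branch: expansion is applied from a small
     [u > 0], where [f u > -1], at a cost of [3 * u <= e]. *)
  pose u := Num.min (b / 2) (e / 3).
  have u0 : 0 < u by rewrite lt_min; lra.
  have ub : u <= b / 2 by rewrite ge_min lexx.
  have ue : u <= e / 3 by rewrite ge_min lexx orbT.
  have bu : br false u by apply/brP; lra.
  have bb : br false b by apply/brP; lra.
  have := f_strict hL bu.
  have := steep_expand H bu bb; rewrite !gtr0_norm; lra.
have nearL a : - r0 < a < 0 -> 3 * - a <= 1 - f a.
  move=> ar0; apply/ler_addgt0Pr => e e0.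
  pose u := Num.min (- a / 2) (e / 3).
  have u0 : 0 < u by rewrite lt_min; lra.
  have ub : u <= - a / 2 by rewrite ge_min lexx.
  have ue : u <= e / 3 by rewrite ge_min lexx orbT.
  have bu : br true (- u) by apply/brP; lra.
  have bb : br true a by apply/brP; lra.
  have := f_strict hL bu.
  have := steep_expand H bb bu; rewrite !ltr0_norm; lra.
move: (Num.sqrt 2) s1 s2 (fun s x y bx b_y => @f_expand _ _ hL s x y bx b_y).
move=> q q1 q2 fe; split => [b b01|a a01].
  have [br0|br0] := ltP b r0.
    have := nearR b ltac:(lra).
    have : q * (1 + r0 / 3) <= 3 by nra.
    nra.
  have bb : br false b by apply/brP; lra.
  (* Cutting at [r0 / 2], the inner part expands by 3 instead of [q < 3 / 2]; as [b <= 1], this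
     surplus exceeds [q * (r0 / 3) * b]. *)
  have bm : br false (r0 / 2) by apply/brP; lra.
  have := fe _ _ _ bm bb ltac:(lra); have := nearR (r0 / 2) ltac:(lra).
  have : q * (r0 / 3) * b <= r0 / 2.
    have : q * (r0 / 3) <= r0 / 2 by nra.
    nra.
  nra.
have [br0|br0] := ltP (- r0) a.
  have := nearL a ltac:(lra).
  have : q * (1 + r0 / 3) <= 3 by nra.
  nra.
have bb : br true a by apply/brP; lra.
have bm : br true (- (r0 / 2)) by apply/brP; lra.
have := fe _ _ _ bb bm ltac:(lra); have := nearL (- (r0 / 2)) ltac:(lra).
have : q * (r0 / 3) * - a <= r0 / 2.
  have : q * (r0 / 3) <= r0 / 2 by nra.
  nra.
nra.
Qed.

Lemma bernoulli_ineq (x : R) n : 0 <= x -> 1 + n%:R * x <= (1 + x) ^+ n.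
Proof.
move=> x0; elim: n => [|n IH]; first by rewrite mul0r addr0 expr0.
have n0 : 0 <= n%:R :> R by rewrite ler0n.
by rewrite exprS -natr1; nra.
Qed.

(** At least one iterate is required, so that an image containing []0, vr[] provides a periodic
    itinerary. *)
Definition reach (a b : R) := exists p sg, covers p.+1 sg 0 (vr L) a b.

Lemma reach_step a b a' b' s : reach a b -> covers 1 (fun=> s) a b a' b' ->
  reach a' b'.
Proof.
move=> [p [sg H]] H'; have := covers_trans H H'.
by rewrite addnC addn1 => ?; exists p.+1, (splice 1 (fun=> s) sg).
Qed.

Lemma reach_expand a b : reach a b -> -1 <= a -> a < b -> b <= 1 ->
  b <= 0 \/ 0 <= a -> exists a' b',
  [/\ reach a' b', -1 <= a' & b' <= 1] /\ Num.sqrt 2 * (b - a) <= b' - a'.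
Proof.
move=> H a1 ab b1; have s1 := @sqrt2_gt R.
have [k kk [cr cl]] := cut_expand.
case=> h.
  have ba : br true a by apply/brP; lra.
  have fa := f_strict hL ba.
  have [b0|b0] := eqVneq b 0.
    subst b; exists (f a), 1; split; last first.
      have ha : -1 <= a < 0 by lra.
      by have := cl a ha; nra.
    split; [|lra|lra]; apply: reach_step H _; apply: covers_left0; lra.
  have bb : br true b.
    by apply/brP; move/eqP : b0 => b0; lra.
  exists (f a), (f b); have fb := f_strict hL bb.
  split; last exact: f_expand hL _ _ _ ba bb (ltW ab).
  split; [|lra|lra]; exact: reach_step H (covers_br ba bb).
have bb : br false b by apply/brP; lra.
have fb := f_strict hL bb.
have [a0|a0] := eqVneq a 0.
  subst a; exists (-1), (f b); split; last first.
    have hb' : 0 < b <= 1 by lra.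
    by have := cr b hb'; nra.
  split; [|lra|lra]; apply: reach_step H _; apply: covers_right0; lra.
have ba : br false a by apply/brP; move/eqP : a0 => a0; lra.
exists (f a), (f b); have fa := f_strict hL ba.
split; last exact: f_expand hL _ _ _ ba bb (ltW ab).
split; [|lra|lra]; exact: reach_step H (covers_br ba bb).
Qed.

(* An interval is cut at 0 into two pieces, one of which has at least half its
   length; two expansions by at least sqrt 2 compensate the cut, strictly since
   f' is large near 0.  As lengths are bounded, 0 must be met twice in a row. *)
Lemma reach_long : (exists2 c, c < 0 & reach c 1) \/
  (exists2 d, 0 < d & reach (-1) d).
Proof.
apply: contrapT => /not_orP[nc nd].
have s1 := @sqrt2_gt R; have [k kk [cr cl]] := cut_expand.
have s22 : Num.sqrt (2 : R) * Num.sqrt 2 = 2 by rewrite -expr2 sqr_sqrtr.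
have vrb := vr_bounds hL; have vlb := vl_bounds hL.
have vr1 : 0 < vr L <= 1 by lra.
have start : reach (-1) (f (vr L)).
  by exists 0%N, (fun=> false); apply: covers_right0.
have grow a b : reach a b -> -1 <= a -> a < b -> b <= 1 -> exists a' b',
  [/\ reach a' b', -1 <= a' & b' <= 1] /\ k * (b - a) <= b' - a'.
  move=> H a1 ab b1.
  have [h|h] := pselect (b <= 0 \/ 0 <= a).
    (* Without a cut a single expansion suffices, since [k <= 4 / 3 < sqrt 2]. *)
    have [a' [b' [H' e]]] := reach_expand H a1 ab b1 h.
    by exists a', b'; split => //; nra.
  move/not_orP : h => [/negP hb /negP ha].
  have {}hb : 0 < b by lra.
  have {}ha : a < 0 by lra.
  (* The longer piece is kept, at least half of the interval. Its image ends at [-1] or [1] and, by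
     [nd] or [nc], does not cross 0, so it expands once more: the total factor is at least
     [sqrt 2 * sqrt 2 * k / 2 = k]. *)
  have [ba|ba] := lerP (- a) b.
    have b01 : 0 < b <= 1 by lra.
    have H1 : reach (-1) (f b).
      apply: reach_step H _; apply: covers_sub (covers_right0 b01) _ _ _ _; lra.
    have fb0 : f b <= 0.
      by rewrite leNgt; apply/negP => fb; apply: nd; exists (f b).
    have fb1 := f_strict hL ltac:(exact: ((brP false b).2 b01)).
    have [a' [b' [H' e]]] := reach_expand H1 ltac:(lra) ltac:(lra) ltac:(lra)
      (or_introl fb0).
    exists a', b'; split => //; have := cr b b01.
    move: (Num.sqrt 2) s1 s22 e => s s1 s22 e e'; have : s * (s * k * b) <= s * (f b + 1).
      by rewrite ler_pM2l//; lra.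
    rewrite !mulrA s22; nra.
  have a01 : -1 <= a < 0 by lra.
  have H1 : reach (f a) 1.
    apply: reach_step H _; apply: covers_sub (covers_left0 a01) _ _ _ _; lra.
  have fb0 : 0 <= f a.
    by rewrite leNgt; apply/negP => fb; apply: nc; exists (f a).
  have fb1 := f_strict hL ltac:(exact: ((brP true a).2 a01)).
  have [a' [b' [H' e]]] := reach_expand H1 ltac:(lra) ltac:(lra) ltac:(lra)
    (or_intror fb0).
  exists a', b'; split => //; have := cl a a01.
  move: (Num.sqrt 2) s1 s22 e => s s1 s22 e e'; have : s * (s * k * - a) <= s * (1 - f a).
    by rewrite ler_pM2l//; lra.
  rewrite !mulrA s22; nra.
have bv : br false (vr L) by apply/brP.
have fv := f_strict hL bv.
pose l0 := f (vr L) + 1; have l00 : 0 < l0 by rewrite /l0; lra.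
have iter_grow n : exists a b, [/\ reach a b, -1 <= a & b <= 1] /\
    k ^+ n * l0 <= b - a.
  elim: n => [|n [a [b [[H a1 b1] e]]]].
    exists (-1), (f (vr L)); split; last by rewrite expr0 mul1r /l0; lra.
    by split => //; lra.
  have kn : 0 < k ^+ n * l0 by rewrite mulr_gt0// exprn_gt0//; lra.
  have [a' [b' [H' e']]] := grow a b H a1 ltac:(lra) b1.
  exists a', b'; split => //; rewrite exprS -mulrA; nra.
have k1 : 0 <= k - 1 by lra.
have k10 : 0 < (k - 1) * l0 by rewrite mulr_gt0//; lra.
(* For this exponent Bernoulli's inequality makes the length exceed 2, that of [[-1, 1]]. *)
have [a [b [[_ a1 b1]]]] := iter_grow (Num.truncn (2 / ((k - 1) * l0))).+1.
set n := _.+1.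
have := bernoulli_ineq n k1; rewrite subrKC.
have : 2 < n%:R * ((k - 1) * l0).
  by rewrite -ltr_pdivrMr//; exact: truncnS_gt.
nra.
Qed.

(** If []c, 1[] is reached, it contains []0, vr[], which thus covers itself; the periodic leaf is
    pushed over []c, 1[], then by the right branch over []-1, vr[]. If []-1, d[] is reached, the
    left branch continues to []vl, 1[], which contains []0, vr[]. *)
Lemma good_cover : forall t : R, -1 < t < 1 ->
  exists a b, good a b /\ a < t < b.
Proof.
have vrb := vr_bounds hL; have vlb := vl_bounds hL.
have [[c c0 [p [sg H]]]|[d d0 [p [sg H]]]] := reach_long => t t1.
  have G0 : good 0 (vr L).
    apply: (@covers_periodic p.+1 sg) => //; apply: covers_sub H _ _ _ _; lra.
  have G1 := covers_good H G0.
  have G2 : good (-1) (vr L).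
    apply: covers_good G1; rewrite -f1E.
    have h1 : 0 < (1 : R) <= 1 by lra.
    apply: covers_sub (covers_right0 h1) _ _ _ _; lra.
  have [tv|tv] := ltP t (vr L); first by exists (-1), (vr L); split => //; lra.
  by exists c, 1; split => //; lra.
have h1 : -1 <= (-1 : R) < 0 by lra.
have H2 : covers 1 (fun=> true) (-1) d (vl L) 1.
  rewrite -fN1E; apply: covers_sub (covers_left0 h1) _ _ _ _; lra.
have H3 := covers_trans H H2.
have G0 : good 0 (vr L).
  apply: (@covers_periodic (1 + p.+1) (splice 1 (fun=> true) sg)) => //.
  apply: covers_sub H3 _ _ _ _; lra.
have [tv|tv] := ltP t d.
  by exists (-1), d; split; [exact: covers_good H G0|lra].
by exists (vl L), 1; split; [exact: covers_good H3 G0|lra].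
Qed.

Lemma U_proj t : -1 < t < 1 -> exists2 z, U z & z.1 = t.
Proof.
move=> /good_cover[a [b [[sg G] tab]]].
have [rz iz zt] := leafptP hL (G t tab); exists (leafpt L sg t) => //.
apply/bigcup_LamP; exists (Num.min (t - a) (b - t)).
  by rewrite lt_min; lra.
split => // u; rewrite zt iz lt_min !ltr_norml => h; apply: G; lra.
Qed.

(** * Images and preimages of U *)

Lemma U_reg z : U z -> reg z. Proof. by move=> [n _ []]. Qed.

(** Close to [z] the leaf stays on one side of 0, and since [f] expands, its image extends at least
    as far on each side of the abscissa of [F z]. *)
Lemma U_F z : U z -> z.1 != 0 -> U (F z).
Proof.
move=> /bigcup_LamP[e e0 [rz H]] z0; apply/bigcup_LamP.
have bz := square_br (reg_square rz) z0; have zb := reg_bounds hL rz.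
set s := z.1 < 0 in bz.
have [e1 e10 [b1 b2 e1e]] : exists2 e1, 0 < e1 &
    [/\ br s (z.1 - e1), br s (z.1 + e1) & e1 < e].
  exists (Num.min (e / 2) (Num.min (`|z.1| / 2) (1 - `|z.1|))).
    by rewrite !lt_min divr_gt0//= divr_gt0 ?normr_gt0//= subr_gt0 ltr_norml.
  set m := Num.min _ _.
  have m1 : m <= e / 2 by rewrite /m ge_min lexx.
  have m2 : m <= `|z.1| / 2 by rewrite /m !ge_min lexx orbT.
  have m3 : m <= 1 - `|z.1| by rewrite /m !ge_min lexx !orbT.
  have m0 : 0 < m.
    by rewrite /m !lt_min divr_gt0//= divr_gt0 ?normr_gt0//= subr_gt0 ltr_norml.
  move/brP : bz m2 m3; case: s => bz.
    by rewrite ltr0_norm => *; [split; try apply/brP|]; lra.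
  by rewrite gtr0_norm => *; [split; try apply/brP|]; lra.
exists e1 => //; split; first exact: reg_F.
move=> t ht; rewrite (itin_F hL rz z0).
have f1 := f_expand1 hL b1 bz; have f2 := f_expand1 hL bz b2.
have tf : f (z.1 - e1) <= t <= f (z.1 + e1).
  by move: ht; rewrite ltr_norml /=; lra.
have dt : dom s t := dom_convex (f_dom hL b1) (f_dom hL b2) tf.
have [hb1 hb2] := hbP hL dt.
apply: (@Dom_add 1) => [[]//|].
rewrite /=; suff : Dom (itin z) (hb s t) by [].
apply: H; have : z.1 - e1 <= hb s t <= z.1 + e1.
  by rewrite -(f_le hL b1 hb1) -(f_le hL hb1 b2) hb2.
by rewrite ltr_norml; lra.
Qed.

(** By continuity of [f], abscissas near that of [pre z] are sent into the domain of the leaf of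
    [z]; the itinerary then loses its first symbol. *)
Lemma U_pre z : U z -> U (pre z).
Proof.
move=> /bigcup_LamP[e e0 [rz H]]; apply/bigcup_LamP.
have [rp p0 Fp] := preP hL rz; have pb := reg_bounds hL rp.
have bp := pre_br hL rz; have e20 : 0 < e / 2 by lra.
have [d d0 Hd] := f_cont hL bp e20.
exists (Num.min d (Num.min `|(pre z).1| (1 - `|(pre z).1|))).
  by rewrite !lt_min d0 normr_gt0 p0 /= subr_gt0 ltr_norml.
split => // t; rewrite !lt_min => /and3P[td t0 t1].
have bt : br (itin z 0) t.
  move/brP : bp t0 t1; rewrite brP; case: (itin z 0) => bp.
    by rewrite [`|(pre z).1|]ltr0_norm ?ltr_norml; lra.
  by rewrite [`|(pre z).1|]gtr0_norm ?ltr_norml; lra.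
have Df : Dom (itin z) (f t).
  apply: H; have := Hd t bt td; rewrite (pre_f hL rz); lra.
have := Dom_hb Df; rewrite (hb_f hL bt).
by rewrite (_ : (fun n => _) = itin (pre z))//; apply/funext => n; rewrite itinS.
Qed.

End OneDimensional.

(** * Leaves, components and density *)

Section Leaves.
Context {R : realType} (L : lorenz_data R) (hL : lorenz_map L).
Local Notation plane := (R * R)%type.
Local Notation M := (Defs.M L).
Local Notation F := (Defs.F L).
Local Notation Fimg := (Defs.Fimg L).
Local Notation reg := (Defs.Lambda_reg L).
Local Notation pre := (pre L).
Local Notation itin := (itin L).
Local Notation Dom := (Dom L).
Local Notation slope := (slope L).
Local Notation leafpt := (leafpt L).
Local Notation U := (\bigcup_n Lam L n).

Definition leaf_arc (sg : nat -> bool) (a b : R) : set plane :=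
  [set leafpt sg t | t in `]a, b[%classic].

Lemma in_oo (a b t : R) : (`]a, b[%classic t) = (a < t < b) :> Prop.
Proof. by rewrite /= in_itv. Qed.

Lemma oo_ball (a b t : R) : a < t < b -> exists2 d, 0 < d &
  forall u, `|u - t| < d -> a < u < b.
Proof.
move=> tab; exists (Num.min (t - a) (b - t)); first by rewrite lt_min; lra.
by move=> u; rewrite lt_min !ltr_norml; lra.
Qed.

Section Arc.
Variables (sg : nat -> bool) (a b : R).
Hypothesis D : forall t, a < t < b -> Dom sg t.

Let P t (tab : a < t < b) := leafptP hL (D tab).

Lemma leafptE t : a < t < b -> leafpt sg t = (t, (leafpt sg t).2).
Proof. by move=> /P[_ _ {2}<-]; rewrite -surjective_pairing. Qed.

Lemma leaf_arc_U : leaf_arc sg a b `<=` U.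
Proof.
move=> _ [t + <-]; rewrite in_oo => tab; have [r i e] := P tab.
have [d d0 H] := oo_ball tab; apply/bigcup_LamP; exists d => //.
by split => // u; rewrite i e => /H/D.
Qed.

Lemma leafpt_derive t : a < t < b ->
  is_derive t (1 : R) (fun u => (leafpt sg u).2) (slope (leafpt sg t)).
Proof.
move=> tab; apply: eps_is_derive => e e0; have [r i et] := P tab.
have [d d0 Hd] := leaf_diff hL r e0; have [d' d'0 H'] := oo_ball tab.
exists (Num.min d d'); first by rewrite lt_min d0.
move=> u; rewrite lt_min => /andP[ud /H' uab]; have [ru iu eu] := P uab.
by have := Hd _ ru; rewrite i iu eu et; apply.
Qed.

Lemma slope_leafpt_cont t : a < t < b ->
  {for t, continuous (fun u => slope (leafpt sg u))}.
Proof.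
move=> tab; have [r i et] := P tab; have [d' d'0 H'] := oo_ball tab.
apply/cvgrPdist_le => e e0; have [d d0 Hd] := slope_cont hL r e0.
apply/nbhs_ballP; exists (Num.min d d') => /=; first by rewrite lt_min d0.
move=> u; rewrite /ball /= lt_min distrC => /andP[ud /H' uab].
have [ru iu eu] := P uab.
by rewrite distrC; apply: (Hd _ ru); rewrite ?i ?iu ?eu ?et.
Qed.

Lemma leafpt_Eu t : a < t < b -> Eu L (leafpt sg t) =
  [set (s, s * slope (leafpt sg t)) | s in setT].
Proof. by move=> /P[r _ _]; exact: Eu_slope. Qed.

Lemma leaf_arc_u_curve : a < b -> u_curve L (leaf_arc sg a b).
Proof.
move=> ab; split; first by move=> z /leaf_arc_U/U_reg.
exists a, b; split => //.
exists id, (fun t => (leafpt sg t).2), (fun=> 1), (fun t => slope (leafpt sg t)).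
split.
- by apply/seteqP; split => _ [t tab <-]; exists t => //;
    move: tab; rewrite in_oo => tab; rewrite -leafptE.
- move=> t; rewrite in_itv /= => tab; split; first exact: is_derive_id.
  exact: leafpt_derive.
- move=> t; rewrite in_itv /= => tab; split; first exact: cst_continuous.
  exact: slope_leafpt_cont.
- move=> t; rewrite in_itv /= => tab; split.
    by apply/eqP => -[] /eqP; rewrite oner_eq0.
  rewrite -leafptE// leafpt_Eu//.
  by apply/seteqP; split => _ [s _ <-]; exists s => //; rewrite mulr1.
Qed.

End Arc.

Lemma path_connected_set (c1 c2 : R -> R) (a b : R) :
  (forall t, a < t < b -> derivable c1 t 1) ->
  (forall t, a < t < b -> derivable c2 t 1) ->
  connected [set (c1 t, c2 t) | t in `]a, b[%classic].
Proof.
move=> d1 d2; apply: connected_continuous_connected.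
  exact/connected_intervalP/interval_is_interval.
have cw (c : R -> R) : (forall t, a < t < b -> derivable c t 1) ->
    {within `]a, b[, continuous c}.
  by move=> dc; apply: derivable_within_continuous => t; rewrite in_itv; exact: dc.
move=> t; apply: (cvg_pair (G := nbhs (c1 t)) (H := nbhs (c2 t))).
- exact: cw d1 t.
- exact: cw d2 t.
Qed.

Lemma leaf_arc_connected sg a b : (forall t, a < t < b -> Dom sg t) ->
  connected (leaf_arc sg a b).
Proof.
move=> D.
have -> : leaf_arc sg a b = [set (t, (leafpt sg t).2) | t in `]a, b[%classic].
  by apply/seteqP; split => _ [t tab <-]; exists t => //;
    move: tab; rewrite in_oo => tab; rewrite -(leafptE D).
apply: (path_connected_set (c1 := id)) => t tab.
  exact: derivable_id.
by have [] := leafpt_derive D tab.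
Qed.

(** A component has a constant itinerary, so it lies in one leaf, and its points, being in [U], are
    over the interior []inf S, sup S[] of the domain. Conversely the arc over this interval is
    connected and contained in [U]. *)
Lemma component_leaf z : U z -> exists a b : R, [/\ a < b,
  forall t, a < t < b -> Dom (itin z) t &
  connected_component U z = leaf_arc (itin z) a b].
Proof.
move=> Uz; have /bigcup_LamP[e e0 [rz H]] := Uz.
pose S := [set t | Dom (itin z) t].
have Sz : S z.1 by exact: Dom_itin.
have Sl : has_lbound S by exists (-1) => t /(Dom_strict hL); lra.
have Su : has_ubound S by exists 1 => t /(Dom_strict hL); lra.
have ball_oo t d : 0 < d -> (forall u, `|u - t| < d -> S u) -> inf S < t < sup S.
  move=> d0 Hd.
  have h1 : inf S <= t - d / 2.
    by apply: ge_inf => //; apply: Hd; rewrite ltr_norml; lra.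
  have h2 : t + d / 2 <= sup S.
    by apply: ub_le_sup => //; apply: Hd; rewrite ltr_norml; lra.
  lra.
have zab : inf S < z.1 < sup S by apply: ball_oo e0 H.
have DS t : inf S < t < sup S -> Dom (itin z) t.
  move=> /andP[t1 t2].
  have [u Su1 ut] := inf_lt (ex_intro _ _ Sz) t1.
  have [v Sv1 tv] := sup_gt (ex_intro _ _ Sz) t2.
  by apply: (Dom_convex hL Su1 Sv1); rewrite !ltW.
exists (inf S), (sup S); split => //; first by case/andP: zab; exact: lt_trans.
have zarc : leaf_arc (itin z) (inf S) (sup S) z.
  by exists z.1; [rewrite in_oo|rewrite leafpt_itin].
apply/seteqP; split; last first.
  by apply: connected_component_max => //;
    [exact: leaf_arc_U|exact: leaf_arc_connected].
move=> w cw; have Uw := connected_component_sub cw.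
have iw : itin w = itin z.
  apply: (connected_itin hL (@component_connected _ U z)) => //.
    by move=> x /connected_component_sub/U_reg.
  exact: connected_component_refl.
have /bigcup_LamP[d d0 [rw Hw]] := Uw.
exists w.1; last by rewrite -iw leafpt_itin.
by rewrite in_oo; apply: (ball_oo _ _ d0); rewrite iw in Hw.
Qed.

Lemma component_u_curve z : U z -> u_curve L (connected_component U z).
Proof.
by move=> /component_leaf[a [b [ab D ->]]]; exact: leaf_arc_u_curve.
Qed.

Lemma u_curve_connected W : u_curve L W -> connected W.
Proof.
move=> [_ [a [b [_ [c1 [c2 [d1 [d2 [-> H _ _]]]]]]]]].
by apply: path_connected_set => t tab; have [[] ? [] ?] := H t tab.
Qed.

(* E^u is nowhere vertical, so the projection of a u-curve to the x-axis is
   open: every point of the curve is interior to the domain of its leaf. *)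
Lemma u_curve_U W : u_curve L W -> W `<=` U.
Proof.
move=> uW; have cW := u_curve_connected uW.
move: uW => [Wr [a [b [ab [c1 [c2 [d1 [d2 [WE Hd _ HE]]]]]]]]] w Ww.
have := Ww; rewrite {1}WE => -[t tI wE]; rewrite in_oo in tI.
have tI' : t \in `]a, b[ by rewrite in_itv.
have [dt0 Et] := HE t tI'; have rw := Wr w Ww.
have d10 : d1 t != 0.
  apply: contraNneq dt0 => d10.
  have : Eu L (c1 t, c2 t) (d1 t, d2 t) by rewrite Et; exists 1; rewrite ?mul1r.
  by rewrite wE Eu_slope// => -[s _ [s0 <-]]; rewrite s0 d10 mul0r.
have onW u : a < u < b -> Dom (itin w) (c1 u).
  move=> uab; have Wu : W (c1 u, c2 u) by rewrite WE; exists u; rewrite ?in_oo.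
  rewrite -(connected_itin hL cW Wr Ww Wu).
  exact: (@Dom_itin _ _ hL (c1 u, c2 u) (Wr _ Wu)).
have [dc1 _] := Hd t tI'.
have l0 : 0 < `|d1 t| / 2 by rewrite divr_gt0// normr_gt0.
have [d d0 Hd1] := is_derive_eps dc1 l0; have [d' d'0 H'] := oo_ball tI.
pose h := Num.min d d' / 2; have h0 : 0 < h by rewrite divr_gt0// lt_min d0.
have hd : h < d.
  have : Num.min d d' <= d by rewrite ge_min lexx.
  by rewrite /h; lra.
have hd' : h < d'.
  have : Num.min d d' <= d' by rewrite ge_min lexx orbT.
  by rewrite /h; lra.
have A (k : R) : `|k| = h -> `|c1 (t + k) - c1 t - d1 t * k| <= `|d1 t| / 2 * h
    /\ Dom (itin w) (c1 (t + k)).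
  move=> kh; have := Hd1 (t + k); rewrite [t + k - t]addrAC subrr add0r kh.
  by move=> /(_ hd); split => //; apply/onW/H'; rewrite addrAC subrr add0r kh.
have [A1 D1] := A h (gtr0_norm h0).
have [A2 D2] := A (- h) ltac:(by rewrite normrN gtr0_norm).
have wt : w.1 = c1 t by rewrite -wE.
(* Between [t - h] and [t + h] the curve moves at least this far to each side of [w.1]; convexity of
   the domain fills the gap. *)
apply/bigcup_LamP; exists (`|d1 t| / 2 * h); first by rewrite mulr_gt0.
split => // u; rewrite wt => hu; move: A1 A2 hu l0; rewrite !ler_norml !ltr_norml.
case: (ger0P (d1 t)) => p A1 A2 hu l0.
  apply: (Dom_convex hL D2 D1); lra.
apply: (Dom_convex hL D1 D2); lra.
Qed.

Lemma component_maximal z : U z ->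
  is_maximal_unstable_manifold L z (connected_component U z).
Proof.
move=> Uz; split; [exact: component_u_curve|exact: connected_component_refl|].
move=> W uW Wz; apply: connected_component_max => //; first exact: u_curve_U.
exact: u_curve_connected.
Qed.

(** Preimages for the bi-valued map agree with [pre]: a passage through the critical line would put
    a regular point on the critical orbit. *)
Lemma iter_Fimg_pre n w x : square w -> reg x -> iter n Fimg [set w] x ->
  iter n pre x = w.
Proof.
move=> sw; have ssw : [set w] `<=` square by move=> _ ->.
elim: n x => [//|n IH] x rx [v iv xv]; rewrite iterSr.
have sv := iter_Fimg_square hL ssw iv.
have [v0|v0] := eqVneq v.1 0.
  by move: xv; rewrite Fval_eq0// => /critical_orbit_crit cx; case: rx.
move: xv; rewrite Fval_neq0// => xv; have pv := pre_unique hL rx sv v0 (esym xv).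
by rewrite pv; apply: IH => //; rewrite -pv; exact: pre_reg.
Qed.

(** The leaf is the required graph: its Lipschitz constant [2 * M] is below [1 / alpha] because
    [alpha * M < 1 / 2]. Conversely a graph as in the definition is connected, so it lies in one
    leaf, which is therefore defined over its whole base. *)
Lemma U_admits alpha z : 0 < alpha -> alpha * M < 1 / 2 ->
  U z <-> admits_unstable_manifold L alpha z.
Proof.
move=> al0 alM; split; last first.
  move=> [rz [eta [eta0 [phi [Wz Wr _ dphi _]]]]].
  apply/bigcup_LamP; exists (eta / 2); first by rewrite divr_gt0.
  split => // t; rewrite ltr_norml => tz.
  have tI : z.1 - eta / 2 < t < z.1 + eta / 2 by lra.
  have Wt : [set (u, phi u) | u in `]z.1 - eta / 2, z.1 + eta / 2[%classic] (t, phi t).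
    by exists t; rewrite ?in_oo.
  rewrite -(connected_itin hL _ Wr Wz Wt).
    exact: (@Dom_itin _ _ hL (t, phi t) (Wr _ Wt)).
  apply: (path_connected_set (c1 := id)) => u uI; first exact: derivable_id.
  by have [|] := dphi u; rewrite ?in_oo.
move=> /bigcup_LamP[e e0 [rz H]]; split => //; exists e; split => //.
exists (fun t => (leafpt (itin z) t).2) => I.
have D t : z.1 - e / 2 < t < z.1 + e / 2 -> Dom (itin z) t.
  by move=> tI; apply: H; rewrite ltr_norml; lra.
have WE t : z.1 - e / 2 < t < z.1 + e / 2 ->
    (t, (leafpt (itin z) t).2) = leafpt (itin z) t.
  by move=> tI; rewrite -(leafptE D).
have Wr t : z.1 - e / 2 < t < z.1 + e / 2 -> reg (leafpt (itin z) t).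
  by move=> /D/(leafptP hL)[].
split.
- exists z.1; first by rewrite /I in_oo; lra.
  by rewrite leafpt_itin// -surjective_pairing.
- by move=> _ [t + <-]; rewrite /I in_oo => tI; rewrite WE//; exact: Wr.
- move=> [x y] [/= xI yI]; move: xI yI; rewrite /I !in_oo => /D xD /D yD.
  have [rx ix ex] := leafptP hL xD; have [ry iy ey] := leafptP hL yD.
  have := leaf_lip hL rx ry; rewrite ix iy ex ey => /(_ erefl) h.
  apply: le_trans h _; rewrite ler_wpM2r//.
  by rewrite -[alpha^-1]mul1r ler_pdivlMr//; lra.
- move=> t; rewrite /I in_oo => tI; have [dt Dt] := leafpt_derive D tI.
  split => //; rewrite derive1E Dt WE//; exact: (leafpt_Eu D).
- move=> n w n0 [sw [x [ix [t + xE]]]]; rewrite /I in_oo => tI.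
  have rx : reg x by rewrite -xE WE//; exact: Wr.
  rewrite -(iter_Fimg_pre sw rx ix); case: n n0 {ix} => // n _.
  exact: iter_pre_neq0.
Qed.

(** Go back [n] steps, pick a point of [U] on the same vertical, and come forward again: each step
    halves the vertical distance, initially at most 2. *)
Lemma U_vertical n z : reg z -> exists w, [/\ U w, w.1 = z.1 &
  `|w.2 - z.2| <= 2 / 2 ^+ n].
Proof.
elim: n z => [|n IH] z rz.
  have [w Uw e] := U_proj hL (reg_bounds hL rz); exists w; split => //.
  rewrite expr0 divr1.
  have /IyP := reg_Iy rz; have /IyP := reg_Iy (U_reg Uw).
  by rewrite ler_norml; lra.
have rp := pre_reg hL rz; have [w [Uw e1 e2]] := IH _ rp.
have bp := pre_br hL rz; have p0 := br_neq0 bp.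
exists (F w); split; first by apply: U_F => //; rewrite e1.
  by rewrite /= e1 pre_f.
rewrite /= -(pre_g hL rz) [w]surjective_pairing e1 [pre z in X in _ - X]surjective_pairing.
have := g_lip_y hL bp (reg_Iy (U_reg Uw)) (reg_Iy rp).
rewrite exprSr invfM mulrA; lra.
Qed.

Lemma reg_closure_U : reg `<=` closure U.
Proof.
move=> z rz V /nbhs_ballP[e /= e0 He].
have e20 : 0 < e / 2 by lra.
have [n Hn] := half_pow_small 2 e20; have [w [Uw e1 e2]] := U_vertical n rz.
exists w; split => //; apply: He; rewrite -ball_normE /= prod_normE /= e1 subrr.
rewrite normr0 gt_max e0 distrC /=; lra.
Qed.

(** A leaf through a point of [U] on the critical line crosses this line; the images of its points
    approaching from side [s] stay in [U] and tend to [crit_pt s]. *)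
Lemma crit_pt_closure_U s : closure U (crit_pt L s).
Proof.
have h0 : -1 < (0 : R) < 1 by lra.
have [z Uz z0] := U_proj hL h0; have rz := U_reg Uz.
have /bigcup_LamP[e e0 [_ H]] := Uz; rewrite z0 in H.
pose G := within (br s) (nbhs (0 : R)).
have PG : ProperFilter G.
  apply: Build_ProperFilter_ex => V; rewrite /G /within /= => /nbhs_ballP[d /= d0 Hd].
  pose u := Num.min (d / 2) 1.
  have u0 : 0 < u by rewrite lt_min ltr01 andbT divr_gt0.
  have ud : u < d by rewrite gt_min; apply/orP; left; lra.
  have u1 : u <= 1 by rewrite ge_min lexx orbT.
  exists (if s then - u else u); apply: Hd.
    by rewrite /ball /= sub0r normrN; case: s {G}; rewrite ?normrN gtr0_norm.
  by apply/brP; case: s {G}; lra.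
have Ge : \forall t \near G, `|t| < e.
  apply: cvg_within; apply/nbhs_ballP; exists e => // t.
  by rewrite /ball /= sub0r normrN.
have M0 := M_gt0' hL.
have LP t : `|t| < e -> [/\ reg (leafpt (itin z) t),
    itin (leafpt (itin z) t) = itin z & (leafpt (itin z) t).1 = t].
  by move=> te; apply: leafptP => //; apply: H; rewrite subr0.
have LU t : `|t| < e -> U (leafpt (itin z) t).
  move=> te; apply: (@leaf_arc_U (itin z) (- e) e).
    by move=> u ue; apply: H; rewrite subr0 ltr_norml; lra.
  by exists t => //; rewrite in_oo -ltr_norml.
have cv : (fun t => leafpt (itin z) t) @ G --> z.
  apply/(@plane_cvgP _ _ G _) => d d0.
  have d10 : 0 < d / (1 + 2 * M) by rewrite divr_gt0//; lra.
  have Gd : \forall t \near G, `|t| < d / (1 + 2 * M).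
    apply: cvg_within; apply/nbhs_ballP; exists (d / (1 + 2 * M)) => // t.
    by rewrite /ball /= sub0r normrN.
  apply: filterS2 Ge Gd => t /LP[r i et] td.
  have := leaf_lip hL r rz i; rewrite et z0 subr0.
  rewrite ltr_pdivlMr in td; last lra.
  by have := normr_ge0 t; split; nra.
apply: (closure_of_cvg PG (a := F \o (fun t => leafpt (itin z) t))).
  apply: (@F_cvg_crit _ _ hL _ s _ _ _ _ cv) => //; first exact: reg_square rz.
    by apply: filterS Ge => t /LP[/reg_square].
  apply: filterS2 Ge (near_withinT _ _ : \forall t \near G, br s t) => t /LP[_ _ ->].
  by [].
apply: filterS2 Ge (near_withinT _ _ : \forall t \near G, br s t) => t te bt /=.
by apply: (U_F hL (LU t te)); have [_ _ ->] := LP t te; exact: br_neq0 bt.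
Qed.

Lemma closure_U_F z : closure U z -> square z -> z.1 != 0 -> closure U (F z).
Proof.
move=> cz sz z0.
have PG : ProperFilter (within U (nbhs z)).
  apply: Build_ProperFilter_ex => V; rewrite /within /= => /cz[w [Uw h]].
  by exists w; exact: h.
have GU : within U (nbhs z) U by exact: withinT.
have Gz : idfun @ within U (nbhs z) --> z by exact: cvg_within.
have Gs : \forall w \near within U (nbhs z), square (idfun w).
  by apply: filterS GU => w /U_reg/reg_square.
apply: (closure_of_cvg PG (a := F \o idfun)); first exact: F_cvg.
have nb := near_same_branch (_ : Filter _) Gz sz z0 Gs.
by apply: filterS2 GU (nb _) => w Uw [bw _]; apply: U_F => //; exact: br_neq0 bw.
Qed.

Lemma critical_orbit_closure_U : critical_orbit L `<=` closure U.
Proof.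
move=> z [n _]; elim: n z => [|n IH] z.
  by move=> [->|->]; [exact: (@crit_pt_closure_U true)|exact: (@crit_pt_closure_U false)].
move=> [v iv zv]; have sv := iter_Fimg_square hL (crit_square hL) iv.
have [v0|v0] := eqVneq v.1 0.
  move: zv; rewrite Fval_eq0//.
  by move=> [->|->]; [exact: (@crit_pt_closure_U true)|exact: (@crit_pt_closure_U false)].
by move: zv; rewrite Fval_neq0// => ->; apply: closure_U_F => //; exact: IH.
Qed.

Lemma attractor_closure_U : attractor L = closure U.
Proof.
apply/seteqP; split; last by apply: (closure_reg_attractor hL); exact: U_reg.
move=> z az; have [cz|cz] := pselect (critical_orbit L z).
  exact: critical_orbit_closure_U.
exact: reg_closure_U.
Qed.

End Leaves.

(** * Ergodic measures *)

Section Ergodicity.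
Context {R : realType} (L : lorenz_data R) (hL : lorenz_map L).
Local Notation plane := (R * R)%type.
Local Notation mplane := (measurableTypeR R * measurableTypeR R)%type.
Local Notation f := (Defs.f L).
Local Notation U := (\bigcup_n Lam L n).

(** An open set is the countable union of the boxes with rational centres and half-sides
    [1 / (n + 1)] that it contains, and boxes are measurable for the product structure. *)
Lemma open_plane_measurable (O : set plane) : open O ->
  measurable (O : set mplane).
Proof.
move=> oO.
pose box (i : rat * rat * nat) : set plane :=
  `](ratr i.1.1 - i.2.+1%:R^-1 : R), (ratr i.1.1 + i.2.+1%:R^-1 : R)[ `*`
  `](ratr i.1.2 - i.2.+1%:R^-1 : R), (ratr i.1.2 + i.2.+1%:R^-1 : R)[.
pose B i : set plane := if `[< box i `<=` O >] then box i else set0.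
have -> : O = \bigcup_i B i.
  apply/seteqP; split => [z Oz|z [i _]]; last first.
    by rewrite /B; case: asboolP => // + bz; apply.
  have /nbhs_ballP[e /= e0 He] : nbhs z O by exact: open_nbhs_nbhs.
  pose n := Num.truncn (2 / e).
  have n0 : 0 < n.+1%:R^-1 :> R by rewrite invr_gt0.
  have ne : 2 * n.+1%:R^-1 <= e.
    rewrite ler_pdivrMr// mulrC -ler_pdivrMr//; exact: ltW (truncnS_gt _).
  have boxE p q (w : plane) : box (p, q, n) w <->
      (`|w.1 - ratr p| < n.+1%:R^-1) /\ (`|w.2 - ratr q| < n.+1%:R^-1).
    by rewrite !ltr_distl /box /setX /= !in_itv.
  move: (n.+1%:R^-1) n0 ne boxE => k k0 ke boxE.
  have [p] := @rat_in_itvoo R (z.1 - k) (z.1 + k) ltac:(lra).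
  have [q] := @rat_in_itvoo R (z.2 - k) (z.2 + k) ltac:(lra).
  rewrite !in_itv /= => hq hp; exists (p, q, n) => //.
  rewrite /B; case: asboolP => [_|].
    by apply/boxE; rewrite !ltr_norml; lra.
  case => w /boxE[]; rewrite !ltr_norml => w1 w2; apply: He.
  by rewrite -ball_normE /= prod_normE /= gt_max !ltr_norml; lra.
apply: countable_bigcupT_measurable => [|i]; first exact: countableP.
rewrite /B; case: asboolP => _; last exact: measurable0.
by apply: measurableX; exact: measurable_itv.
Qed.

Lemma closed_plane_measurable (A : set plane) : closed A ->
  measurable (A : set mplane).
Proof.
move=> cA; rewrite -[A]setCK; apply: measurableC.
by apply: open_plane_measurable; exact: closed_openC.
Qed.

Lemma U_measurable : measurable (U : set mplane).
Proof.
apply: bigcup_measurable => n _; apply: closed_plane_measurable.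
by apply: compact_closed; [exact: norm_hausdorff|exact: Lam_compact].
Qed.

(* Restricted to [-1, 1], as f is arbitrary elsewhere. *)
Fixpoint hits_zero (n : nat) : set R :=
  if n is m.+1 then [set t | t = 0 \/ (-1 <= t <= 1 /\ hits_zero m (f t))]
  else set0.

(** Each step adds 0 and pulls a countable set back through two inverse branches. *)
Lemma hits_zero_countable n : countable (hits_zero n).
Proof.
elim: n => [|n IH]; first exact: countable0.
apply: (@sub_countable _ _ _ ([set 0] `|` (\bigcup_s (hb L s @` hits_zero n)))).
  apply: subset_card_le => t [->|[tI Ht]]; first by left.
  have [->|t0] := eqVneq t 0; first by left.
  right; exists (t < 0) => //; exists (f t) => //.
  by rewrite (hb_f hL)//; exact: br_of.
rewrite -bigcup2E; apply: bigcup_countable => // -[|[|k]] _ //=.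
apply: bigcup_countable => // s _; apply: sub_countable IH.
exact: card_image_le.
Qed.

(** The points of [U] whose orbit avoids the critical line at times 0 to [n - 1]. *)
Definition U_until (n : nat) : set plane := U `&` ~` (fst @^-1` hits_zero n).

Lemma hits_zero_measurable n : measurable (fst @^-1` hits_zero n : set mplane).
Proof.
have -> : (fst @^-1` hits_zero n : set mplane) = hits_zero n `*` setT.
  by apply/seteqP; split => z //= [].
apply: measurableX; last exact: measurableT.
by apply: countable_measurable (hits_zero_countable n) => t; exact: measurable_set1.
Qed.

Lemma U_until_measurable n : measurable (U_until n : set mplane).
Proof.
apply: measurableI; first exact: U_measurable.
by apply: measurableC; exact: hits_zero_measurable.
Qed.

Lemma U_square : U `<=` square.
Proof. by move=> z /U_reg/reg_square. Qed.

(** The values on the critical line belong to the critical orbit, hence not to [U]; elsewhere [U_F]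
    and [U_pre] apply. By invariance all the [U_until n] then have the same measure. *)
Lemma Fsel_U_until left n :
  square `&` Fsel L left @^-1` (U_until n) = U_until n.+1.
Proof.
apply/seteqP; split => z.
  move=> [sz]; rewrite /preimage /= /Fsel; have [z0|z0] := eqVneq z.1 0.
    move=> [/U_reg[_ +] _]; case; apply: critical_orbit_crit.
    by case: left; [left|right].
  move=> [UF nF]; have rF := U_reg UF.
  split; first by rewrite -(pre_unique hL rF sz z0 erefl); exact: U_pre.
  by move=> [e|[_ H]]; [rewrite e eqxx in z0|exact: nF].
move=> [Uz nz]; have sz := U_square Uz.
have z0 : z.1 != 0 by apply/eqP => z0; apply: nz; left.
split => //; rewrite /preimage /= /Fsel (negPf z0); split; first exact: U_F.
by move=> H; apply: nz; right; split => //; have /squareP[] := sz.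
Qed.

Lemma U_until_sub n : U_until n.+1 `<=` U_until n.
Proof.
move=> z [Uz nz]; split => // hz; apply: nz; clear Uz.
move: hz; rewrite /preimage /=; elim: n z.1 => [//|n IH] t /=.
by move=> [->|[tI H]]; [left|right; split => //; exact: (IH (f t) H)].
Qed.

(** The decreasing intersection [A] of the [U_until n] has the measure of [U] and is exactly
    invariant, so ergodicity applies to it. *)
Lemma ergodic_U left (mu : probability mplane R) : is_ergodic L left mu ->
  mu U = 0%E \/ mu U = 1%E.
Proof.
move=> [[_ inv] erg].
have muU n : mu (U_until n) = mu U.
  elim: n => [|n <-].
    by congr (mu _); apply/seteqP; split => z; [case|split].
  by rewrite -(Fsel_U_until left) inv//; exact: U_until_measurable.
pose A : set mplane := \bigcap_n U_until n.
have mA : measurable A by apply: bigcap_measurableType => n _; exact: U_until_measurable.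
have -> : mu U = mu A.
  have cv : (mu \o U_until) n @[n --> \oo] --> mu A.
    apply: nonincreasing_cvg_mu => //.
    - by apply: le_lt_trans (probability_le1 _ _) (ltry _); exact: U_until_measurable.
    - exact: U_until_measurable.
    - apply/nonincreasing_seqP => n; rewrite subsetEset; exact: U_until_sub.
  have <- : lim ((mu \o U_until) n @[n --> \oo]) = mu A by apply/cvg_lim.
  by apply/esym/lim_near_cst => //; apply: nearW => n; exact: muU.
apply: erg => //.
have As : A `<=` square by move=> z /(_ 0%N I)[/U_square].
rewrite [RHS](setIidr As); apply/seteqP; split => z.
  (* [Fsel_U_until] describes positive indices only; index 0 follows from index 1 by inclusion. *)
  move=> [sz Fz] [|n] _; last by rewrite -(Fsel_U_until left); split => //; exact: Fz.
  apply: U_until_sub; rewrite -(Fsel_U_until left); split => //; exact: Fz.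
move=> Az; split; first exact: As.
by move=> n _; have := Az n.+1 I; rewrite -(Fsel_U_until left) => -[].
Qed.

End Ergodicity.

Unset Implicit Arguments.
Set Strict Implicit.

Theorem theoremC (R : realType) (L : lorenz_data R) (hL : lorenz_map L)
    (alpha : R) (halpha : 0 < alpha) (halphaM : alpha * M L < 1 / 2) :
  exists Lam : nat -> set (R * R)%type,
    let U := \bigcup_n Lam n in
    (forall n, compact (Lam n)) /\
    (forall n, Lam n `<=` Lam n.+1) /\
    (forall n, Lam n `<=` attractor L) /\
    attractor L = closure U /\
    (forall z, U z -> u_curve L (connected_component U z)) /\
    (forall z, U z <-> admits_unstable_manifold L alpha z) /\
    (forall z, U z ->
       is_maximal_unstable_manifold L z (connected_component U z)) /\
    (forall (left : bool)
            (mu : probability (measurableTypeR R * measurableTypeR R)%type R),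
       is_ergodic L left mu -> mu U = 0%E \/ mu U = 1%E).
Proof.
exists (Lam L) => U.
split; first exact: Lam_compact hL.
split; first by move=> n; exact: Lam_mono.
split; first by move=> n; exact: Lam_attractor.
split; first exact: attractor_closure_U hL.
split; first exact: component_u_curve hL.
split; first by move=> z; exact: U_admits.
split; first exact: component_maximal hL.
exact: ergodic_U hL.
Qed.
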